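(* Let $g,L,h>0$ and let $\bar\rho=\bar\rho(y_2)\in C^5(\overline\Omega)$ satisfy $\inf_\Omega\bar\rho>0$, $\bar\rho'(s)>0$ for some $s\in(0,h)$, and $\inf_{y_2\in(0,h)}|\bar\rho'(y_2)|>0$. Then $$0<\kappa_{\mathrm C}\le\frac{g\,\|\bar\rho'\|_{L^\infty}\,\|(\bar\rho')^{-1}\|_{L^\infty}^2}{\pi^2h^{-2}+L^{-2}} .$$ In particular, if $\bar\rho$ is linear (so $\bar\rho'$ is a positive constant), then $$\kappa_{\mathrm C}=\frac{g}{(\pi^2h^{-2}+L^{-2})\,\bar\rho'} .$$
   Context: $\Omega=2\pi L\mathbb T\times(0,h)$: functions on $\Omega$ are $2\pi L$-periodic in $y_1$; $\partial\Omega=\{y_2=0\}\cup\{y_2=h\}$; $\int:=\int_{(0,2\pi L)\times(0,h)}$. $H^1_\sigma=\{w\in H^1(\Omega)^2:\mathrm{div}\,w=0,\ w_2|_{\partial\Omega}=0\}$ and $$\kappa_{\mathrm C}:=\sup_{w\in H^1_\sigma}\frac{g\int\bar\rho' w_2^2\,\mathrm dy}{\int|\bar\rho'\nabla w_2|^2\,\mathrm dy},$$ the supremum being over $w$ with nonzero denominator. *)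

(* Defs.v *)
From HB Require Import structures.
From mathcomp Require Import all_boot all_order all_algebra.
From mathcomp Require Import all_classical all_reals all_analysis.

Set Implicit Arguments.
Unset Strict Implicit.
Unset Printing Implicit Defensive.

Import Order.TTheory GRing.Theory Num.Def Num.Theory.
Import numFieldNormedType.Exports.

Local Open Scope classical_set_scope.
Local Open Scope ring_scope.

(* A function on Omega = (2 pi L T) x (0, h) is a function on R * R, periodic
   in its first variable; integrals are taken over one period cell. *)

Definition periodic1 {R : realType} (L : R) (u : R * R -> R) : Prop :=
  forall y, u (y.1 + 2 * pi * L, y.2) = u y.

Definition Omega {R : realType} (L h : R) : set (R * R) :=
  `]0, 2 * pi * L[ `*` `]0, h[.

Definition leb2 (R : realType) :
    {measure set (measurableTypeR R * measurableTypeR R) -> \bar R} :=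
  (@lebesgue_measure R \x @lebesgue_measure R)%E.

Definition intO {R : realType} (L h : R) (f : R * R -> R) : R :=
  \int[leb2 R]_(y in Omega L h) f y.

Definition L2 {R : realType} (L h : R) (u : R * R -> R) : Prop :=
  periodic1 L u /\ (u \_ (Omega L h)) \in Lfun (leb2 R) 2%:E.

Definition normLoo {R : realType} (L h : R) (u : R * R -> R) : \bar R :=
  ('N[leb2 R]_+oo[EFin \o (u \_ (Omega L h))])%E.

Definition e1 {R : realType} : R * R := (1, 0).
Definition e2 {R : realType} : R * R := (0, 1).

Fixpoint Ck {R : realType} (k : nat) (f : R * R -> R) : Prop :=
  if k is k'.+1 then
    (forall y, derivable f y e1 /\ derivable f y e2) /\ continuous f /\
    Ck k' ('D_e1 f) /\ Ck k' ('D_e2 f)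
  else continuous f.

(* Restricted to R x [0, h], these are the elements of C^oo(closure Omega). *)
Definition smooth_periodic {R : realType} (L : R) (f : R * R -> R) : Prop :=
  periodic1 L f /\ forall k, Ck k f.

(* C_c^oo(Omega): compactness of the support on the cylinder only constrains
   the second variable. *)
Definition test_function {R : realType} (L h : R) (phi : R * R -> R) : Prop :=
  smooth_periodic L phi /\
  exists a b : R, [/\ 0 < a, b < h &
    forall y, y.2 \notin `[a, b] -> phi y = 0].

Definition weak_partial {R : realType} (L h : R) (e : R * R)
    (u v : R * R -> R) : Prop :=
  forall phi, test_function L h phi ->
    intO L h (fun y => u y * 'D_e phi y) = - intO L h (fun y => v y * phi y).

(* An element of H^1(Omega), bundled with its weak gradient (which is
   determined almost everywhere by the function). *)
Record H1 {R : realType} (L h : R) := MkH1 {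
  H1fun :> R * R -> R;
  d1 : R * R -> R;
  d2 : R * R -> R;
  H1_L2 : L2 L h H1fun;
  d1_L2 : L2 L h d1;
  d2_L2 : L2 L h d2;
  d1_weak : weak_partial L h e1 H1fun d1;
  d2_weak : weak_partial L h e2 H1fun d2
}.

(* [t] is the trace of [u] on {y_2 = 0} and {y_2 = h}: the trace operator is
   the continuous extension to H^1(Omega) of the restriction of functions in
   C^oo(closure Omega) to the boundary, with values in L^2. *)
Definition is_trace {R : realType} (L h : R) (u : H1 L h)
    (t : R * R -> R) : Prop :=
  exists f : nat -> R * R -> R,
  [/\ forall n, smooth_periodic L (f n),
      (fun n => intO L h (fun y =>
         (f n y - u y) ^+ 2 + ('D_e1 (f n) y - d1 u y) ^+ 2 +
         ('D_e2 (f n) y - d2 u y) ^+ 2)) @ \oo --> (0 : R)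
    & forall b, b = 0 \/ b = h ->
      ((fun x => t (x, b)) \_ `]0, 2 * pi * L[)
        \in Lfun (@lebesgue_measure R) 2%:E /\
      (fun n => \int[@lebesgue_measure R]_(x in `]0, 2 * pi * L[)
         (f n (x, b) - t (x, b)) ^+ 2) @ \oo --> (0 : R)].

Definition H1sigma {R : realType} {L h : R} (w : H1 L h * H1 L h) : Prop :=
  {ae leb2 R, forall y, Omega L h y -> d1 w.1 y + d2 w.2 y = 0} /\
  is_trace w.2 (cst 0).

Definition kappaC_num {R : realType} (g L h : R) (rho : R -> R)
    (w : H1 L h * H1 L h) : R :=
  g * intO L h (fun y => derive1 rho y.2 * w.2 y ^+ 2).

Definition kappaC_den {R : realType} (L h : R) (rho : R -> R)
    (w : H1 L h * H1 L h) : R :=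
  intO L h (fun y =>
    (derive1 rho y.2 * d1 w.2 y) ^+ 2 + (derive1 rho y.2 * d2 w.2 y) ^+ 2).

Definition kappaC {R : realType} (g L h : R) (rho : R -> R) : \bar R :=
  ereal_sup [set (kappaC_num g rho w / kappaC_den rho w)%:E |
    w in [set w : H1 L h * H1 L h | H1sigma w /\ kappaC_den rho w != 0]].

(* C^k([0, h]): the derivatives up to order [k] exist in the open interval and
   extend continuously to the closed one. *)
Definition Ck_closed {R : realType} (k : nat) (h : R) (rho : R -> R) : Prop :=
  forall j, (j <= k)%N ->
    ((j < k)%N -> forall x, x \in `]0, h[ -> derivable (derive1n j rho) x 1) /\
    exists r : R -> R, {within `[0, h], continuous r} /\
      {in `]0, h[, derive1n j rho =1 r}.

(* Main.v *)
Require Import Defs.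
From HB Require Import structures.
From mathcomp Require Import all_boot all_order all_algebra.
From mathcomp Require Import all_classical all_reals all_analysis.
From mathcomp Require Import measurable_realfun ess_sup_inf ring lra.
Import Order.TTheory GRing.Theory Num.Def Num.Theory.
Import numFieldNormedType.Exports.
Local Open Scope classical_set_scope.
Local Open Scope ring_scope.

Set Implicit Arguments.
Unset Strict Implicit.
Unset Printing Implicit Defensive.

(** For [w] in [H1sigma], [w_2] satisfies the sharp Poincare inequality
    [(pi^2/h^2 + 1/L^2) int w_2^2 <= int |grad w_2|^2], from which the bounds on
    the quotient follow by estimating the weights [rho'] pointwise a.e.
    Vertically, [w_2] vanishes on the boundary; horizontally, [w_2] has zero mean
    on every circle [{y_2 = b}]: since [d_2 w_2 = - d_1 w_1], testing the weak
    derivative [d_1 w_1] against cutoffs depending on [y_2] only gives that the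
    integral of [d_2 w_2] over [{0 < y_2 < b}] vanishes, and [w_2] vanishes at
    [y_2 = 0].
    Both one-dimensional inequalities come from the field
    [c(x) = - k tan (k (x - m))], which solves [c' = - k^2 - c^2], with [k]
    slightly below the critical value, so that no singularity occurs and nonzero
    boundary values are allowed; they are applied to the smooth functions
    approximating [w_2] in the definition of the trace, and pass to the limit.
    Equality for constant [rho'] and positivity in general come from
    [w_2 = sin (y_1 / L) sin (pi y_2 / h)]. *)

(** * Integration of continuous functions over the cell *)

(** The obstacle is that the smooth functions approximating [w_2] inherit none of its structure:
    they need not vanish on the walls, and their circle means need not be zero, since the divergence
    constraint couples [w_2] to [w_1] and is lost under approximation. Each inequality for smooth
    functions therefore carries an explicit error term, boundary values vertically and squared slice
    integrals horizontally, and both errors are controlled by the trace and by the [H^1] distance to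
    [w_2]. On an interval of length [l] with zero boundary values the critical value of [k] is
    [pi / l]. The height [h] gives [pi / h]. A period [2 pi L] gives [1 / L] because a periodic
    function takes equal values at two points half a period apart: subtracting that value leaves two
    Dirichlet problems on intervals of length [pi L], and no Fourier series is needed. The weight
    occurs once in the numerator and squared in the denominator, whence the product of the sup norm
    of [rho'] and the squared sup norm of its inverse; for a constant weight [a] this collapses to
    [1 / a]. *)

Lemma open_measurable_prod (R : realType) (A : set (R * R)) :
  open A -> measurable (A : set (measurableTypeR R * measurableTypeR R)).
Proof.
move=> oA.
(* Products of balls with rational centres and radii [n.+1%:R^-1] form a countable base of the
   plane; [A] is the countable union of those it contains, and each is a measurable rectangle. *)
pose B (p q : rat) (n : nat) : set (R * R) :=
  ball (ratr p : R) n.+1%:R^-1 `*` ball (ratr q : R) n.+1%:R^-1.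
rewrite (_ : A = \bigcup_p \bigcup_q \bigcup_n
    (if `[< B p q n `<=` A >] then B p q n else set0)); last first.
  apply/seteqP; split; last first.
    by move=> x [p _ [q _ [n _]]]; case: asboolP => // BA /BA.
  move=> [x y] Axy.
  have /nbhs_ballP[e /= e0 eA] : nbhs (x, y) A by exact: open_nbhs_nbhs.
  have [n ne] : exists n, n.+1%:R^-1 < e / 2.
    have [n _ /(_ n (leqnn n)) ne] := near_infty_natSinv_lt (PosNum (divr_gt0 e0 (ltr0n R 2))).
    by exists n.
  have approx (z : R) : exists p : rat, ball (ratr p : R) n.+1%:R^-1 z.
    have [w [zp [p _ pw]]] : ball z n.+1%:R^-1 `&` range (@ratr R) !=set0.
      apply: dense_rat; last exact: ball_open.
      by exists z; apply: ballxx; rewrite invr_gt0.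
    by exists p; rewrite pw; exact: ball_sym.
  have [p px] := approx x; have [q qy] := approx y.
  exists p => //; exists q => //; exists n => //.
  case: asboolP; first by move=> _; split.
  case=> -[x' y'] [/= px' qy']; apply: eA; split => /=.
    rewrite (splitr e); apply: (@ball_triangle _ _ (ratr p : R) x x').
      by apply: ball_sym; apply: le_ball px; exact: ltW.
    by apply: le_ball px'; exact: ltW.
  rewrite (splitr e); apply: (@ball_triangle _ _ (ratr q : R) y y').
    by apply: ball_sym; apply: le_ball qy; exact: ltW.
  by apply: le_ball qy'; exact: ltW.
apply: bigcupT_measurable_rat => p; apply: bigcupT_measurable_rat => q.
apply: bigcupT_measurable => n; case: ifP => _ //.
by apply: measurableX; apply: open_measurable; exact: ball_open.
Qed.

Lemma continuous_measurable_prod (R : realType) (f : R * R -> R) :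
  continuous f ->
  measurable_fun setT (f : measurableTypeR R * measurableTypeR R -> R).
Proof.
move=> cf; apply: (measurability _ (RGenOpens.measurableE R)) => _ [_ [a [b ->] <-]].
by rewrite setTI; apply: open_measurable_prod; move/continuousP: cf; apply; exact: interval_open.
Qed.

Lemma measurable_Omega (R : realType) (L h : R) :
  measurable (Omega L h : set (measurableTypeR R * measurableTypeR R)).
Proof. by apply: measurableX; exact: measurable_itv. Qed.

Lemma lebesgue_itvoo (R : realType) (a b : R) : a <= b ->
  lebesgue_measure (`]a, b[%classic : set R) = (b - a)%:E.
Proof.
move=> ab; rewrite lebesgue_measure_itv/= lte_fin.
by case: ltP => // ba; rewrite (@le_anti _ _ a b) ?ab// subrr.
Qed.

Lemma Rintegral_cst_oo (R : realType) (a b c : R) : a <= b ->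
  \int[@lebesgue_measure R]_(x in `]a, b[) c = c * (b - a).
Proof.
move=> ab; rewrite Rintegral_cst; last exact: measurable_itv.
by rewrite /= lebesgue_itvoo.
Qed.

Lemma leb2_Omega (R : realType) (L h : R) : 0 < L -> 0 < h ->
  leb2 R (Omega L h) = (2 * pi * L * h)%:E.
Proof.
move=> L0 h0.
have P0 : 0 <= 2 * pi * L by rewrite !mulr_ge0// ?pi_ge0// ltW.
transitivity ((@lebesgue_measure R) `]0%R, (2 * pi * L)%R[%classic *
              (@lebesgue_measure R) `]0%R, h[%classic)%E.
  by apply: product_measure1E; exact: measurable_itv.
by rewrite !lebesgue_itvoo// ?(ltW h0)// !subr0 -EFinM.
Qed.

Lemma continuous_bounded_Omega (R : realType) (L h : R) (f : R * R -> R) :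
  continuous f -> exists2 M : R, 0 < M & forall y, Omega L h y -> `|f y| <= M.
Proof.
move=> cf.
have : bounded_set (f @` (`[0, 2 * pi * L] `*` `[0, h])).
  apply/compact_bounded/continuous_compact.
    exact: continuous_subspaceT.
  by apply: compact_setX; exact: segment_compact.
case=> M [_ HM]; exists (`|M| + 1); first by rewrite ltr_wpDl.
move=> y [/= y1 y2]; apply: HM; first by rewrite (le_lt_trans (ler_norm _))// ltrDl.
by exists y => //; split; exact: subset_itv_oo_cc.
Qed.

Lemma continuous_integrable_Omega (R : realType) (L h : R) (f : R * R -> R) :
  0 < L -> 0 < h -> continuous f ->
  (leb2 R).-integrable (Omega L h) (EFin \o f).
Proof.
move=> L0 h0 cf; apply: measurable_bounded_integrable.
- exact: measurable_Omega.
- by rewrite leb2_Omega ?ltry.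
- by apply: measurable_funTS; exact: continuous_measurable_prod.
have [M M0 HM] := continuous_bounded_Omega L h cf.
exists M; split; first exact: num_real.
by move=> x Mx y /HM fy; exact: (le_trans fy (ltW Mx)).
Qed.

Lemma continuous_slice1 (R : realType) (f : R * R -> R) y :
  continuous f -> continuous (fun x => f (x, y)).
Proof.
move=> cf x; apply: (@continuous_comp _ _ _ (fun x => (x, y)) f); last exact: cf.
by apply: (@cvg_pair _ _ _ (nbhs x) (nbhs x) (nbhs y)); [exact: cvg_id|exact: cvg_cst].
Qed.

Lemma continuous_slice2 (R : realType) (f : R * R -> R) x :
  continuous f -> continuous (fun y => f (x, y)).
Proof.
move=> cf y; apply: (@continuous_comp _ _ _ (fun y => (x, y)) f); last exact: cf.
by apply: (@cvg_pair _ _ _ (nbhs y) (nbhs x) (nbhs y)); [exact: cvg_cst|exact: cvg_id].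
Qed.

Lemma continuous_integrable_oo (R : realType) (f : R -> R) (a b : R) :
  {within `[a, b], continuous f} ->
  (@lebesgue_measure R).-integrable `]a, b[ (EFin \o f).
Proof.
move=> cf.
have : (@lebesgue_measure R).-integrable `[a, b] (EFin \o f).
  by apply: continuous_compact_integrable => //; exact: segment_compact.
by apply: integrableS => //; exact: subset_itv_oo_cc.
Qed.

Lemma intO_cell (R : realType) (L h : R) (f : R * R -> R) :
  0 < L -> 0 < h -> continuous f ->
  [/\ (@lebesgue_measure R).-integrable `]0, 2 * pi * L[
        (fun x => (\int[@lebesgue_measure R]_(y in `]0, h[) f (x, y))%:E),
      intO L h f = \int[@lebesgue_measure R]_(x in `]0, 2 * pi * L[)
         \int[@lebesgue_measure R]_(y in `]0, h[) f (x, y),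
      (@lebesgue_measure R).-integrable `]0, h[
        (fun y => (\int[@lebesgue_measure R]_(x in `]0, 2 * pi * L[) f (x, y))%:E) &
      intO L h f = \int[@lebesgue_measure R]_(y in `]0, h[)
         \int[@lebesgue_measure R]_(x in `]0, 2 * pi * L[) f (x, y)].
Proof.
move=> L0 h0 cf.
pose I : set R := `]0, 2 * pi * L[%classic; pose J : set R := `]0, h[%classic.
have mI : measurable (I : set (measurableTypeR R)) by exact: measurable_itv.
have mJ : measurable (J : set (measurableTypeR R)) by exact: measurable_itv.
(* Extension by zero turns the cell into the whole plane, where Fubini applies; [s1E] and [s2E]
   identify the slices of [F] with one-dimensional integrals again extended by zero. *)
pose F : measurableTypeR R * measurableTypeR R -> \bar R :=
  (EFin \o f) \_ (Omega L h).
have iF2 : (leb2 R).-integrable setT F.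
  apply/(integrable_mkcond _ (measurable_Omega L h)).
  exact: continuous_integrable_Omega.
have iF : ((@lebesgue_measure R) \x (@lebesgue_measure R))%E.-integrable setT F.
  exact: iF2.
have OE : (\int[leb2 R]_(y in Omega L h) (f y)%:E = \int[(@lebesgue_measure R) \x (@lebesgue_measure R)]_y F y)%E.
  by rewrite integral_mkcond.
have s2E x : (\int[(@lebesgue_measure R)]_y F (x, y) =
    ((fun x => (\int[(@lebesgue_measure R)]_(y in J) f (x, y))%:E) \_ I) x)%E.
  rewrite patchE; case: ifPn => xI.
    rewrite fineK; last first.
      apply: integrable_fin_num => //.
      apply: (continuous_integrable_oo (f := fun y => f (x, y)) (a := 0) (b := h)).
      exact/continuous_subspaceT/continuous_slice2.
    rewrite [RHS]integral_mkcond; apply: eq_integral => y _.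
    rewrite /F !patchE /Omega; congr (if _ then _ else _).
    by apply/idP/idP; rewrite !inE/=; [case|move=> yJ; split => //; exact/set_mem].
  apply: integral0_eq => y _; rewrite /F patchE memNset//= => -[xI' _].
  by move: xI; rewrite mem_set.
have s1E y : (\int[(@lebesgue_measure R)]_x F (x, y) =
    ((fun y => (\int[(@lebesgue_measure R)]_(x in I) f (x, y))%:E) \_ J) y)%E.
  rewrite patchE; case: ifPn => yJ.
    rewrite fineK; last first.
      apply: integrable_fin_num => //.
      apply: (continuous_integrable_oo (f := fun x => f (x, y)) (a := 0) (b := 2 * pi * L)).
      exact/continuous_subspaceT/continuous_slice1.
    rewrite [RHS]integral_mkcond; apply: eq_integral => x _.
    rewrite /F !patchE /Omega; congr (if _ then _ else _).
    by apply/idP/idP; rewrite !inE/=; [case|move=> xI; split => //; exact/set_mem].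
  apply: integral0_eq => x _; rewrite /F patchE memNset//= => -[_ yJ'].
  by move: yJ; rewrite mem_set.
split.
- apply/integrable_mkcond => //.
  have := integrable_fubini_F iF; congr (integrable _ _ _).
  by apply/funext => x; exact: s2E.
- rewrite /intO [in LHS]/Rintegral OE -integral12_prod_meas1//.
  rewrite [in RHS]/Rintegral [in RHS]integral_mkcond; congr fine.
  by apply: eq_integral => x _; exact: s2E.
(* Here Fubini supplies the measurability only; integrability follows from the uniform bound
   [M * (2 * pi * L)] on an interval of finite length. *)
- have [M M0 HM] := continuous_bounded_Omega L h cf.
  pose G (y : R) : R := \int[@lebesgue_measure R]_(x in I) f (x, y).
  suff : (@lebesgue_measure R).-integrable J (EFin \o G) by [].
  apply: measurable_bounded_integrable => //.
  + by rewrite /= /J lebesgue_itvoo ?ltry// ltW.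
  + apply/measurable_EFinP; apply/(measurable_restrictT _ mJ).
    have := measurable_fubini_G iF; congr (measurable_fun _ _).
    by apply/funext => x; exact: s1E.
  exists (M * (2 * pi * L)); split; first exact: num_real.
  move=> x Mx y yJ; apply: le_trans (ltW Mx).
  have iI : (@lebesgue_measure R).-integrable I (EFin \o fun x => f (x, y)).
    apply: (continuous_integrable_oo (f := fun x => f (x, y)) (a := 0) (b := 2 * pi * L)).
    exact/continuous_subspaceT/continuous_slice1.
  apply: le_trans (le_normr_Rintegral mI iI) _.
  have P0 : 0 <= 2 * pi * L by rewrite !mulr_ge0// ?pi_ge0// ltW.
  have <- : \int[@lebesgue_measure R]_(x in I) M = M * (2 * pi * L).
    by rewrite Rintegral_cst_oo// subr0.
  apply: le_Rintegral => //.
  + by apply/integrable_norm: iI.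
  + by apply: continuous_integrable_oo; apply: continuous_subspaceT; exact: cst_continuous.
  + by move=> z zI; apply: HM; split.
- rewrite /intO [in LHS]/Rintegral OE -integral21_prod_meas1//.
  rewrite [in RHS]/Rintegral [in RHS]integral_mkcond; congr fine.
  by apply: eq_integral => x _; exact: s1E.
Qed.

(** * One-dimensional inequalities *)

Lemma within_continuousM (R : realType) (A : set R) (f g : R -> R) :
  {within A, continuous f} -> {within A, continuous g} ->
  {within A, continuous (fun x => f x * g x)}.
Proof. by move=> cf cg x; apply: cvgM; [exact: cf|exact: cg]. Qed.

Lemma within_continuousD (R : realType) (A : set R) (f g : R -> R) :
  {within A, continuous f} -> {within A, continuous g} ->
  {within A, continuous (fun x => f x + g x)}.
Proof. by move=> cf cg x; apply: cvgD; [exact: cf|exact: cg]. Qed.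

Lemma within_continuous_derive (R : realType) (a b : R) (f f' : R -> R) :
  {in `[a, b], forall x : R, is_derive x 1 f (f' x)} ->
  {within `[a, b], continuous f}.
Proof.
by move=> df; apply: derivable_within_continuous => x /df[].
Qed.

Lemma Rintegral_derive (R : realType) (F f : R -> R) a b : a <= b ->
  {in `[a, b], forall x : R, is_derive x 1 F (f x)} ->
  {within `[a, b], continuous f} ->
  \int[@lebesgue_measure R]_(x in `]a, b[) f x = F b - F a.
Proof.
rewrite le_eqVlt => /predU1P[<- _ _|ab dF cf].
  by rewrite set_itv_ge ?bnd_simp ?ltxx// Rintegral_set0 subrr.
have cF := within_continuous_derive dF.
rewrite Rintegral_itv_bndo_bndc; last exact: continuous_integrable_oo.
rewrite Rintegral_itv_obnd_cbnd; last first.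
  apply: (@integrableS _ _ _ (@lebesgue_measure R) `[a, b]%classic) => //.
    by apply: subset_itvr; rewrite bnd_simp.
  by apply: continuous_compact_integrable => //; exact: segment_compact.
rewrite /Rintegral (@continuous_FTC2 _ f F a b)//.
  split.
  - by move=> x xab; have /dF[] : x \in `[a, b] by exact: subset_itv_oo_cc.
  - by have /(continuous_within_itvP _ ab)[] := cF.
  - by have /(continuous_within_itvP _ ab)[] := cF.
by move=> x xab; rewrite derive1E; have /dF[] : x \in `[a, b] by exact: subset_itv_oo_cc.
Qed.

(** The field is the logarithmic derivative of [u = cos (k (x - m))], and the Riccati equation is
    [u'' = - k^2 u] in disguise. It is regular wherever [u] does not vanish, in particular on
    intervals around [m] of half-length below [pi / (2 k)]. *)
Lemma is_derive_tan_affine (R : realType) (k m x : R) : cos (k * (x - m)) != 0 ->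
  is_derive x 1 (fun x => - k * tan (k * (x - m)))
    (- k ^+ 2 - (- k * tan (k * (x - m))) ^+ 2).
Proof.
move=> c0.
have dx : is_derive x 1 (fun x : R => k * (x - m)) k.
  apply: is_derive_eq. rewrite /GRing.scale/= ?subr0. by rewrite ?mulr1.
have dt := is_derive_tan c0.
have := @is_derive1_comp _ tan (fun x : R => k * (x - m)) x _ _ dt dx.
move=> d1.
have d2 := is_deriveZ (- k) d1.
apply: is_derive_eq d2 _.
rewrite /GRing.scale/= cos2_tan2//; ring.
Qed.

Lemma within_continuousB (R : realType) (A : set R) (f g : R -> R) :
  {within A, continuous f} -> {within A, continuous g} ->
  {within A, continuous (fun x => f x - g x)}.
Proof. by move=> cf cg x; apply: cvgB; [exact: cf|exact: cg]. Qed.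

(* With c = - k tan (k (x - m)) one has c' = - k^2 - c^2, so that
   (c f^2)' = f'^2 - k^2 f^2 - (f' - c f)^2. *)
Lemma tan_calibrated_le (R : realType) (f f' : R -> R) (a b k m : R) : a <= b ->
  (forall x : R, is_derive x 1 f (f' x)) -> continuous f' ->
  {in `[a, b], forall x, cos (k * (x - m)) != 0} ->
  k ^+ 2 * \int[@lebesgue_measure R]_(x in `]a, b[) f x ^+ 2 -
    k * tan (k * (b - m)) * f b ^+ 2 + k * tan (k * (a - m)) * f a ^+ 2 <=
  \int[@lebesgue_measure R]_(x in `]a, b[) f' x ^+ 2.
Proof.
move=> ab df cf' ck.
pose c (x : R) := - k * tan (k * (x - m)).
have dc : {in `[a, b], forall x : R, is_derive x 1 c (- k ^+ 2 - c x ^+ 2)}.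
  by move=> x /ck; exact: is_derive_tan_affine.
pose g (x : R) := (- k ^+ 2 - c x * c x) * (f x * f x) + c x * (2 * f x * f' x).
have dG : {in `[a, b], forall x : R, is_derive x 1 (fun x => c x * f x ^+ 2) (g x)}.
  move=> x /dc dcx; have dfx := df x.
  apply: is_derive_eq; rewrite /GRing.scale/= /g; ring.
have cc : {within `[a, b], continuous c} := within_continuous_derive dc.
have cf : continuous f.
  move=> x; have [dfx _] := df x; apply: differentiable_continuous.
  exact/derivable1_diffP.
have wf : {within `[a, b], continuous f} by exact: continuous_subspaceT.
have wf' : {within `[a, b], continuous f'} by exact: continuous_subspaceT.
have wcst (r : R) : {within `[a, b], continuous (fun _ : R => r)}.
  by apply: continuous_subspaceT; exact: cst_continuous.
have cg : {within `[a, b], continuous g}.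
  apply: within_continuousD; apply: within_continuousM => //.
  - by apply: within_continuousB => //; exact: within_continuousM.
  - exact: within_continuousM.
  - by do 2 apply: within_continuousM => //.
have cf2 : {within `[a, b], continuous (fun x => f x ^+ 2)}.
  exact: (within_continuousM wf wf).
have cf'2 : {within `[a, b], continuous (fun x => f' x ^+ 2)}.
  exact: (within_continuousM wf' wf').
have if2 := continuous_integrable_oo cf2.
have if'2 := continuous_integrable_oo cf'2.
have ikf2 : (@lebesgue_measure R).-integrable `]a, b[ (EFin \o (fun x => k ^+ 2 * f x ^+ 2)).
  by apply: continuous_integrable_oo; exact: within_continuousM.
have /esym intg := Rintegral_derive ab dG cg.
have le : \int[@lebesgue_measure R]_(x in `]a, b[) g x <=
    \int[@lebesgue_measure R]_(x in `]a, b[) (f' x ^+ 2 - k ^+ 2 * f x ^+ 2).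
  apply: le_Rintegral.
  - exact: measurable_itv.
  - exact: continuous_integrable_oo.
  - by apply: continuous_integrable_oo; apply: within_continuousB => //; exact: within_continuousM.
  - move=> x _; rewrite -subr_ge0 (_ : _ - _ = (f' x - c x * f x) ^+ 2) ?sqr_ge0//.
    by rewrite /g; ring.
move: le; rewrite -intg RintegralB// RintegralZl//.
rewrite /c; lra.
Qed.

Lemma Rintegral_split (R : realType) (f : R -> R) (a b c : R) : a <= b -> b <= c ->
  continuous f ->
  \int[@lebesgue_measure R]_(x in `]a, c[) f x =
  \int[@lebesgue_measure R]_(x in `]a, b[) f x +
  \int[@lebesgue_measure R]_(x in `]b, c[) f x.
Proof.
move=> ab; rewrite le_eqVlt => /predU1P[<- _|bc cf].
  by rewrite [X in _ + X](_ : _ = 0) ?addr0// set_itv_ge ?bnd_simp ?ltxx// Rintegral_set0.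
have i u v : (@lebesgue_measure R).-integrable `]u, v[ (EFin \o f).
  by apply: continuous_integrable_oo; exact: continuous_subspaceT.
rewrite [X in X + _]Rintegral_itv_bndo_bndc//.
rewrite -(@Rintegral_itvB _ f (BRight a) (BLeft c) b) ?bnd_simp//.
by rewrite addrC subrK.
Qed.

Lemma cos_neq0_scale (R : realType) (k r y : R) :
  0 < k -> k * r < pi / 2 -> - r <= y <= r -> cos (k * y) != 0.
Proof.
move=> k0 kr /andP[ry yr]; rewrite gt_eqF// cos_gt0_pihalf//; apply/andP; split.
  by rewrite ltrNl (le_lt_trans _ kr)// -mulrN ler_pM2l// lerNl.
by rewrite (le_lt_trans _ kr)// ler_pM2l.
Qed.

(** Left continuity of the square at [K]. It recovers the sharp constant from estimates with [k]
    strictly below the critical value, and also removes the factors [k < 1] lost when comparing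
    squares in [L^2]. *)
Lemma sqr_le_lim (R : realType) (K A B : R) : 0 < K ->
  (forall k : R, 0 < k < K -> k ^+ 2 * A <= B) -> K ^+ 2 * A <= B.
Proof.
move=> K0 kAB.
have c : (k ^+ 2 * A) @[k --> K^'-] --> K ^+ 2 * A.
  apply: cvg_at_left_filter; apply: cvgM; last exact: cvg_cst.
  exact: exprn_continuous.
apply: (cvgr_to_le c); near=> k; apply: kAB; apply/andP; split.
  by near: k; exact: nbhs_left_gt.
by near: k; exact: nbhs_left_lt.
Unshelve. all: by end_near. Qed.

(** The difference [f (x + p) - f x] takes opposite values at [0] and [p], so the intermediate value
    theorem gives a zero. *)
Lemma antiperiodic_point (R : realType) (f : R -> R) (p : R) : 0 <= p ->
  continuous f -> f (p + p) = f 0 ->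
  exists2 x0 : R, x0 \in `[0, p] & f (x0 + p) = f x0.
Proof.
move=> p0 cf fp.
have cq : {within `[0, p], continuous (fun x => f (x + p) - f x)}.
  apply: continuous_subspaceT => x; apply: cvgB; last exact: cf.
  by apply: (@continuous_comp _ _ _ (fun x => x + p) f); [by apply: cvgD; [exact: cvg_id|exact: cvg_cst]|exact: cf].
have [|x0 x0p] := @IVT _ (fun x => f (x + p) - f x) 0 p 0 p0 cq.
  rewrite add0r fp ge_min le_max; case: (leP (f p) (f 0)) => [?|/ltW ?]; lra.
by move=> /eqP; rewrite subr_eq0 => /eqP; exists x0.
Qed.

(** The Dirichlet constant of a half period, of length [pi L], is already [1 / L^2]. Subtracting
    [f x0] instead of the mean costs nothing: the mean minimises the integral of [(f - c)^2] over
    constants [c], and the gap is the square divided by [P] at the end. *)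
Lemma wirtinger (R : realType) (L : R) (f f' : R -> R) : 0 < L ->
  (forall x : R, is_derive x 1 f (f' x)) -> continuous f' ->
  (forall x, f (x + 2 * pi * L) = f x) ->
  L^-1 ^+ 2 * (\int[@lebesgue_measure R]_(x in `]0, 2 * pi * L[) f x ^+ 2 -
    (\int[@lebesgue_measure R]_(x in `]0, 2 * pi * L[) f x) ^+ 2 / (2 * pi * L)) <=
  \int[@lebesgue_measure R]_(x in `]0, 2 * pi * L[) f' x ^+ 2.
Proof.
move=> L0 df cf' fP; set P := 2 * pi * L.
have pi0 := pi_gt0 R.
have P0 : 0 < P by rewrite /P !mulr_gt0.
apply: sqr_le_lim; first by rewrite invr_gt0.
move=> k /andP[k0 kL].
(* [P / 4] is half the length of a half period: fields centred in a half period have no pole on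
   it. *)
have kP : k * (P / 4) < pi / 2.
  rewrite (_ : P / 4 = L * (pi / 2)); last by rewrite /P; field.
  rewrite mulrA gtr_pMl ?divr_gt0//.
  by rewrite -(ltr_pM2r L0) mulVf ?gt_eqF in kL.
have cf : continuous f.
  move=> x; have [dfx _] := df x; apply: differentiable_continuous.
  exact/derivable1_diffP.
(* [f - f x0] vanishes at [x0] and [x0 + P / 2], which cut the period into two
   intervals of length [P / 2]; the one through [P] is [0, x0] and [x0 + P / 2, P],
   whose contributions at [0] and [P] cancel by periodicity. *)
have [||x0 x0P fx0] := @antiperiodic_point _ f (P / 2) _ cf.
- by rewrite divr_ge0// ltW.
- by rewrite -splitr -[in LHS](add0r P) fP.
move: x0P; rewrite in_itv/= => /andP[x00 x0P].
pose F x := f x - f x0.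
have dF (x : R) : is_derive x 1 F (f' x).
  by have dfx := df x; apply: is_derive_eq; rewrite subr0.
have cF2 : continuous (fun x => F x ^+ 2).
  have cF : continuous F by move=> x; apply: cvgB; [exact: cf|exact: cvg_cst].
  by move=> x; apply: cvgM; exact: cF.
have cf'2 : continuous (fun x => f' x ^+ 2).
  by move=> x; apply: cvgM; exact: cf'.
have i (u : R -> R) a b : continuous u -> (@lebesgue_measure R).-integrable `]a, b[ (EFin \o u).
  by move=> cu; apply: continuous_integrable_oo; exact: continuous_subspaceT.
have Fx0 : F x0 = 0 by rewrite /F subrr.
have Fx1 : F (x0 + P / 2) = 0 by rewrite /F fx0 subrr.
(* [x0 - P / 4] is the centre of the half period ending at [x0], of which [[0, x0]] is only a part.
   The remaining part is treated in [h3], shifted by [P] together with its field, so that [t] comes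
   back with the opposite sign. *)
pose t := k * tan (k * (0 - (x0 - P / 4))) * F 0 ^+ 2.
have h1 : k ^+ 2 * \int[@lebesgue_measure R]_(x in `]0, x0[) F x ^+ 2 + t <=
    \int[@lebesgue_measure R]_(x in `]0, x0[) f' x ^+ 2.
  apply: le_trans (tan_calibrated_le (k := k) (m := x0 - P / 4) x00 dF cf' _).
    by rewrite Fx0 /t; lra.
  move=> x; rewrite in_itv/= => /andP[? ?]; apply: (cos_neq0_scale k0 kP).
  by apply/andP; split; lra.
have h2 : k ^+ 2 * \int[@lebesgue_measure R]_(x in `]x0, x0 + P / 2[) F x ^+ 2 <=
    \int[@lebesgue_measure R]_(x in `]x0, x0 + P / 2[) f' x ^+ 2.
  apply: le_trans (tan_calibrated_le (k := k) (m := x0 + P / 4) _ dF cf' _).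
  - by rewrite Fx0 Fx1; lra.
  - by lra.
  move=> x; rewrite in_itv/= => /andP[? ?]; apply: (cos_neq0_scale k0 kP).
  by apply/andP; split; lra.
have h3 : k ^+ 2 * \int[@lebesgue_measure R]_(x in `]x0 + P / 2, P[) F x ^+ 2 - t <=
    \int[@lebesgue_measure R]_(x in `]x0 + P / 2, P[) f' x ^+ 2.
  apply: le_trans (tan_calibrated_le (k := k) (m := x0 - P / 4 + P) _ dF cf' _).
  - rewrite Fx1 (_ : F P = F 0); last by rewrite /F -(fP 0) add0r.
    by rewrite (_ : P - (x0 - P / 4 + P) = 0 - (x0 - P / 4)) /t; [lra|ring].
  - by lra.
  move=> x; rewrite in_itv/= => /andP[? ?]; apply: (cos_neq0_scale k0 kP).
  by apply/andP; split; lra.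
have split3 (u : R -> R) : continuous u ->
    \int[@lebesgue_measure R]_(x in `]0, P[) u x =
    \int[@lebesgue_measure R]_(x in `]0, x0[) u x +
    \int[@lebesgue_measure R]_(x in `]x0, x0 + P / 2[) u x +
    \int[@lebesgue_measure R]_(x in `]x0 + P / 2, P[) u x.
  move=> cu; rewrite -!Rintegral_split//; lra.
have Fle : k ^+ 2 * \int[@lebesgue_measure R]_(x in `]0, P[) F x ^+ 2 <=
    \int[@lebesgue_measure R]_(x in `]0, P[) f' x ^+ 2.
  rewrite (split3 _ cF2) (split3 _ cf'2); lra.
apply: le_trans Fle; apply: ler_wpM2l; first exact: sqr_ge0.
have -> : \int[@lebesgue_measure R]_(x in `]0, P[) F x ^+ 2 =
    \int[@lebesgue_measure R]_(x in `]0, P[) f x ^+ 2 -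
    2 * f x0 * \int[@lebesgue_measure R]_(x in `]0, P[) f x + f x0 ^+ 2 * P.
  have cf2 : continuous (fun x => f x ^+ 2) by move=> x; apply: cvgM; exact: cf.
  have czf : continuous (fun x => 2 * f x0 * f x).
    by move=> x; apply: cvgM; [exact: cvg_cst|exact: cf].
  rewrite -RintegralZl//; last exact: i.
  rewrite -RintegralB//; [|exact: i|exact: i].
  rewrite -[in X in _ + X](subr0 P) -Rintegral_cst_oo; last exact: ltW.
  rewrite -RintegralD//; [|apply: i|apply: i].
  - by apply: eq_Rintegral => x _; rewrite /F; ring.
  - by move=> x; apply: cvgB; [exact: cf2|exact: czf].
  - exact: cst_continuous.
rewrite -subr_ge0; set m := \int[@lebesgue_measure R]_(x in `]0, P[) f x.
rewrite (_ : _ - _ = (m - f x0 * P) ^+ 2 / P); last by field; rewrite gt_eqF.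
by rewrite divr_ge0 ?sqr_ge0 ?ltW.
Qed.

(** * Inequalities for smooth functions on the cell *)

Lemma integrable_EFinD d (T : measurableType d) (R : realType)
    (mu : {measure set T -> \bar R}) (D : set T) (f g : T -> R) : measurable D ->
  mu.-integrable D (EFin \o f) -> mu.-integrable D (EFin \o g) ->
  mu.-integrable D (EFin \o (fun x => f x + g x)).
Proof. by move=> mD fi gi; exact: (integrableD mD fi gi). Qed.

Lemma integrable_EFinB d (T : measurableType d) (R : realType)
    (mu : {measure set T -> \bar R}) (D : set T) (f g : T -> R) : measurable D ->
  mu.-integrable D (EFin \o f) -> mu.-integrable D (EFin \o g) ->
  mu.-integrable D (EFin \o (fun x => f x - g x)).
Proof. by move=> mD fi gi; exact: (integrableB mD fi gi). Qed.

Lemma integrable_EFinZ d (T : measurableType d) (R : realType)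
    (mu : {measure set T -> \bar R}) (D : set T) (k : R) (f : T -> R) : measurable D ->
  mu.-integrable D (EFin \o f) ->
  mu.-integrable D (EFin \o (fun x => k * f x)).
Proof. by move=> mD fi; exact: (integrableZl mD k fi). Qed.

Lemma is_derive_slice1 (R : realType) (f : R * R -> R) (x y : R) :
  derivable f (x, y) e1 ->
  is_derive x 1 (fun x => f (x, y)) ('D_e1 f (x, y)).
Proof.
move=> df.
have E : (fun t : R => t^-1 *: (f (t *: e1 + (x, y)) - f (x, y))) =
    (fun t : R => t^-1 *: (f (t *: (1 : R) + x, y) - f (x, y))).
  apply/funext => t; congr (_ *: (f _ - _)).
  by rewrite [LHS]surjective_pairing /= scaler0 add0r.
by split; [rewrite /derivable -E|rewrite /derive -E].
Qed.

Lemma is_derive_slice2 (R : realType) (f : R * R -> R) (x y : R) :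
  derivable f (x, y) e2 ->
  is_derive y 1 (fun y => f (x, y)) ('D_e2 f (x, y)).
Proof.
move=> df.
have E : (fun t : R => t^-1 *: (f (t *: e2 + (x, y)) - f (x, y))) =
    (fun t : R => t^-1 *: (f (x, t *: (1 : R) + y) - f (x, y))).
  apply/funext => t; congr (_ *: (f _ - _)).
  by rewrite [LHS]surjective_pairing /= scaler0 add0r.
by split; [rewrite /derivable -E|rewrite /derive -E].
Qed.

Lemma Ck_continuous (R : realType) k (f : R * R -> R) : Ck k f -> continuous f.
Proof. by case: k => //= k [_ []]. Qed.

Lemma Ck1P (R : realType) k (f : R * R -> R) : Ck k.+1 f ->
  [/\ forall x y : R, is_derive x 1 (fun x => f (x, y)) ('D_e1 f (x, y)),
      forall x y : R, is_derive y 1 (fun y => f (x, y)) ('D_e2 f (x, y)),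
      continuous f, continuous ('D_e1 f) & continuous ('D_e2 f)].
Proof.
move=> [df [cf [cf1 cf2]]]; split => //.
- by move=> x y; apply: is_derive_slice1; have [] := df (x, y).
- by move=> x y; apply: is_derive_slice2; have [] := df (x, y).
- exact: Ck_continuous cf1.
- exact: Ck_continuous cf2.
Qed.

Lemma continuous_sqr (R : realType) (T : topologicalType) (f : T -> R) :
  continuous f -> continuous (fun x => f x ^+ 2).
Proof. by move=> cf x; apply: cvgM; exact: cf. Qed.

Lemma integrable_slice (R : realType) (f : R -> R) a b : continuous f ->
  (@lebesgue_measure R).-integrable `]a, b[ (EFin \o f).
Proof.
by move=> cf; apply: continuous_integrable_oo; exact: continuous_subspaceT.
Qed.

(** Calibration on each vertical segment with the field centred at [h / 2], so that both walls get
    the same factor. The wall terms are kept because the lemma is applied to functions whose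
    boundary values are merely small. *)
Lemma dirichlet_cell_le (R : realType) (L h k : R) (f : R * R -> R) :
  0 < L -> 0 < h -> 0 < k < pi / h -> Ck 1 f ->
  k ^+ 2 * intO L h (fun y => f y ^+ 2) <=
  intO L h (fun y => 'D_e2 f y ^+ 2) +
  k * tan (k * (h / 2)) *
    (\int[@lebesgue_measure R]_(x in `]0, 2 * pi * L[) f (x, 0) ^+ 2 +
     \int[@lebesgue_measure R]_(x in `]0, 2 * pi * L[) f (x, h) ^+ 2).
Proof.
move=> L0 h0 /andP[k0 kh] /Ck1P[_ d2 cf _ cf2].
have cff := continuous_sqr cf; have cff2 := continuous_sqr cf2.
have [i1 -> _ _] := intO_cell L0 h0 cff.
have [i2 -> _ _] := intO_cell L0 h0 cff2.
set P := 2 * pi * L; set c := k * tan _.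
have i0 := integrable_slice 0 P (continuous_slice1 (y:=0) cff).
have ih := integrable_slice 0 P (continuous_slice1 (y:=h) cff).
have mI : measurable (`]0, P[%classic : set (measurableTypeR R)).
  exact: measurable_itv.
have i0h := integrable_EFinD mI i0 ih.
have ci0h := integrable_EFinZ c mI i0h.
rewrite -RintegralZl// -RintegralD// -RintegralZl// -RintegralD//.
apply: le_Rintegral => //.
- exact: integrable_EFinZ.
- exact: integrable_EFinD.
move=> x _.
have dfx : forall y : R, is_derive y 1 (fun y => f (x, y)) ('D_e2 f (x, y)) by [].
have := @tan_calibrated_le _ (fun y => f (x, y)) (fun y => 'D_e2 f (x, y)) 0 h k (h / 2)
  (ltW h0) dfx (continuous_slice2 (x:=x) cf2).
rewrite (_ : h - h / 2 = h / 2); last by field.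
rewrite sub0r mulrN tanN => H; rewrite /c.
suff /H : {in `[0, h], forall y : R, cos (k * (y - h / 2)) != 0} by lra.
move=> y; rewrite in_itv/= => /andP[y0 yh].
apply: (@cos_neq0_scale _ k (h / 2)) => //; last by apply/andP; split; lra.
by rewrite mulrA ltr_pM2r ?invr_gt0// -ltr_pdivlMr.
Qed.

(** [B] measures the failure of the zero mean condition on circles; integrating the one-dimensional
    defect over the height gives the error [B / (2 pi L) * h]. *)
Lemma wirtinger_cell_le (R : realType) (L h B : R) (f : R * R -> R) :
  0 < L -> 0 < h -> Ck 1 f -> periodic1 L f ->
  (forall y : R, y \in `]0, h[ ->
    (\int[@lebesgue_measure R]_(x in `]0, 2 * pi * L[) f (x, y)) ^+ 2 <= B) ->
  L^-1 ^+ 2 * (intO L h (fun y => f y ^+ 2) - B / (2 * pi * L) * h) <=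
  intO L h (fun y => 'D_e1 f y ^+ 2).
Proof.
move=> L0 h0 /Ck1P[d1 _ cf cf1 _] fP HB.
have cff := continuous_sqr cf; have cff1 := continuous_sqr cf1.
have [_ _ i1 ->] := intO_cell L0 h0 cff.
have [_ _ i2 ->] := intO_cell L0 h0 cff1.
have P0 : 0 < 2 * pi * L by rewrite !mulr_gt0// pi_gt0.
set P := 2 * pi * L in P0 HB *.
have mJ : measurable (`]0, h[%classic : set (measurableTypeR R)).
  exact: measurable_itv.
have ic : (@lebesgue_measure R).-integrable `]0, h[ (EFin \o (fun=> B / P)).
  by apply: integrable_slice; exact: cst_continuous.
rewrite -[X in _ * (_ - _ * X)](subr0 h) -(@Rintegral_cst_oo _ 0 h) ?(ltW h0)//.
rewrite -RintegralB// -RintegralZl//; last exact: integrable_EFinB.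
apply: le_Rintegral => //.
- by apply: integrable_EFinZ => //; exact: integrable_EFinB.
move=> y yJ.
have dfy : forall x : R, is_derive x 1 (fun x => f (x, y)) ('D_e1 f (x, y)) by [].
apply: le_trans (wirtinger L0 dfy (continuous_slice1 (y:=y) cf1) (fun x => fP (x, y))).
rewrite ler_pM2l ?exprn_gt0 ?invr_gt0// lerD2l lerN2 ler_pM2r ?invr_gt0//.
exact: HB.
Qed.

Lemma intO_De2 (R : realType) (L h : R) (f : R * R -> R) : 0 < L -> 0 < h -> Ck 1 f ->
  intO L h ('D_e2 f) =
  \int[@lebesgue_measure R]_(x in `]0, 2 * pi * L[) f (x, h) -
  \int[@lebesgue_measure R]_(x in `]0, 2 * pi * L[) f (x, 0).
Proof.
move=> L0 h0 /Ck1P[_ d2 cf _ cf2].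
have [_ -> _ _] := intO_cell L0 h0 cf2.
rewrite -RintegralB//; try exact: integrable_slice (continuous_slice1 cf).
apply: eq_Rintegral => x _.
apply: (@Rintegral_derive _ (fun y => f (x, y))); first exact: ltW.
  by move=> y _; exact: d2.
exact/continuous_subspaceT/(continuous_slice2 cf2).
Qed.

Lemma intO_De1 (R : realType) (L h : R) (f : R * R -> R) : 0 < L -> 0 < h -> Ck 1 f ->
  periodic1 L f -> intO L h ('D_e1 f) = 0.
Proof.
move=> L0 h0 /Ck1P[d1 _ cf cf1 _] fP.
have [_ _ _ ->] := intO_cell L0 h0 cf1.
have P0 : 0 <= 2 * pi * L by rewrite !mulr_ge0// ?pi_ge0// ltW.
rewrite -[RHS](mul0r (h - 0)) -(@Rintegral_cst_oo _ 0 h) ?(ltW h0)//.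
apply: eq_Rintegral => y _; rewrite (@Rintegral_derive _ (fun x => f (x, y)))//.
- by have := fP (0, y); rewrite /= add0r => ->; rewrite subrr.
- exact/continuous_subspaceT/(continuous_slice1 cf1).
Qed.

(** * Square-integrable functions *)

(** Measurability of [u] is a separate requirement because it does not follow from that of
    [u ^+ 2]. *)
Definition sqintegrable d (T : measurableType d) (R : realType)
    (mu : {measure set T -> \bar R}) (D : set T) (u : T -> R) :=
  measurable_fun D u /\ mu.-integrable D (EFin \o (fun x => u x ^+ 2)).

Lemma sqintegrableM d (T : measurableType d) (R : realType)
    (mu : {measure set T -> \bar R}) (D : set T) (u v : T -> R) : measurable D ->
  sqintegrable mu D u -> sqintegrable mu D v ->
  mu.-integrable D (EFin \o (fun x => u x * v x)).
Proof.
move=> mD [mu1 iu] [mv iv].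
apply: (le_integrable mD _ _ (integrable_EFinD mD iu iv)).
  by apply/measurable_EFinP; exact: measurable_funM.
move=> x _ /=; rewrite lee_fin [leRHS]ger0_norm ?addr_ge0 ?sqr_ge0//.
by rewrite ler_norml; apply/andP; split; nra.
Qed.

Lemma sqintegrableZ d (T : measurableType d) (R : realType)
    (mu : {measure set T -> \bar R}) (D : set T) (k : R) (u : T -> R) : measurable D ->
  sqintegrable mu D u -> sqintegrable mu D (fun x => k * u x).
Proof.
move=> mD [mu1 iu]; split; first exact: measurable_funM.
have := integrable_EFinZ (k ^+ 2) mD iu; congr (integrable _ _ _).
by apply/funext => x /=; rewrite exprMn.
Qed.

Lemma sqintegrableD d (T : measurableType d) (R : realType)
    (mu : {measure set T -> \bar R}) (D : set T) (u v : T -> R) : measurable D ->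
  sqintegrable mu D u -> sqintegrable mu D v ->
  sqintegrable mu D (fun x => u x + v x).
Proof.
move=> mD uD vD; have iuv := sqintegrableM mD uD vD.
case: uD vD => [mu1 iu] [mv iv]; split; first exact: measurable_funD.
have := integrable_EFinD mD (integrable_EFinD mD iu iv) (integrable_EFinZ 2 mD iuv).
congr (integrable _ _ _).
by apply/funext => x /=; congr EFin; ring.
Qed.

Lemma sqintegrableB d (T : measurableType d) (R : realType)
    (mu : {measure set T -> \bar R}) (D : set T) (u v : T -> R) : measurable D ->
  sqintegrable mu D u -> sqintegrable mu D v ->
  sqintegrable mu D (fun x => u x - v x).
Proof.
move=> mD uD vD; have := sqintegrableD mD uD (sqintegrableZ (-1) mD vD).
by congr (sqintegrable _ _ _); apply/funext => x; rewrite mulN1r.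
Qed.

Lemma sqintegrableS d (T : measurableType d) (R : realType)
    (mu : {measure set T -> \bar R}) (D E : set T) (u : T -> R) :
  measurable D -> measurable E -> E `<=` D ->
  sqintegrable mu D u -> sqintegrable mu E u.
Proof.
move=> mD mE ED [mu1 iu]; split; first exact: measurable_funS mu1.
exact: integrableS iu.
Qed.

Lemma sqintegrable_cst d (T : measurableType d) (R : realType)
    (mu : {measure set T -> \bar R}) (D : set T) (c : R) : measurable D ->
  (mu D < +oo)%E -> sqintegrable mu D (fun=> c).
Proof.
move=> mD Doo; split; first exact: measurable_cst.
apply: measurable_bounded_integrable => //.
exists (`|c ^+ 2|); split; first exact: num_real.
by move=> x cx y _; exact: ltW.
Qed.

Lemma sqintegrable_integrable d (T : measurableType d) (R : realType)
    (mu : {measure set T -> \bar R}) (D : set T) (u : T -> R) : measurable D ->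
  (mu D < +oo)%E -> sqintegrable mu D u -> mu.-integrable D (EFin \o u).
Proof.
move=> mD Doo uD.
have := sqintegrableM mD uD (sqintegrable_cst 1 mD Doo); congr (integrable _ _ _).
by apply/funext => x /=; rewrite mulr1.
Qed.

(** Cauchy-Schwarz against the constant one: the integral of [(u - c)^2] is nonnegative for every
    [c], and [c = m / V], the mean, is the optimal choice. *)
Lemma Rintegral_sqr_le d (T : measurableType d) (R : realType)
    (mu : {measure set T -> \bar R}) (D : set T) (u : T -> R) : measurable D ->
  (mu D < +oo)%E -> sqintegrable mu D u ->
  (\int[mu]_(x in D) u x) ^+ 2 <= fine (mu D) * \int[mu]_(x in D) u x ^+ 2.
Proof.
move=> mD Doo uD.
have iu := sqintegrable_integrable mD Doo uD.
have [mu1 iu2] := uD.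
set m := \int[mu]_(x in D) u x; set V := fine (mu D).
have V0 : 0 <= V by exact: fine_ge0.
have ic (c : R) : mu.-integrable D (EFin \o fun=> c).
  exact: (sqintegrable_integrable mD Doo (sqintegrable_cst c mD Doo)).
have key (c : R) : 0 <= \int[mu]_(x in D) u x ^+ 2 - 2 * c * m + c ^+ 2 * V.
  have <- : \int[mu]_(x in D) ((u x - c) ^+ 2) =
      \int[mu]_(x in D) u x ^+ 2 - 2 * c * m + c ^+ 2 * V.
    rewrite -RintegralZl// -RintegralB//; last exact: integrable_EFinZ.
    rewrite -Rintegral_cst// -RintegralD//.
      by apply: eq_Rintegral => x _; ring.
    by apply: integrable_EFinB => //; exact: integrable_EFinZ.
  by apply: Rintegral_ge0 => x _; exact: sqr_ge0.
have [V1|] := ltP 0 V.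
  have := key (m / V); rewrite -(pmulr_rge0 _ V1).
  have -> : V * (\int[mu]_(x in D) u x ^+ 2 - 2 * (m / V) * m + (m / V) ^+ 2 * V) =
     V * \int[mu]_(x in D) u x ^+ 2 - m ^+ 2 by field; rewrite gt_eqF.
  by rewrite subr_ge0.
move=> V1; have V2 : V = 0 by apply/le_anti; rewrite V0 V1.
rewrite V2 mul0r; set S := \int[mu]_(x in D) u x ^+ 2 in key.
have [->|m0] := eqVneq m 0; first by rewrite expr0n.
(* On a null set the expression is affine in [c]; this [c] makes it [S - 2 (S + 1)], which is
   negative, so [m] must vanish. *)
have := key ((S + 1) / m); rewrite V2 mulr0 addr0 -mulrA divfK//.
have S0 : 0 <= S by apply: Rintegral_ge0 => x _; exact: sqr_ge0.
lra.
Qed.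

Lemma L2_sqintegrable (R : realType) (L h : R) (u : R * R -> R) :
  L2 L h u -> sqintegrable (leb2 R) (Omega L h) u.
Proof.
move=> [_ uL]; have mO := measurable_Omega L h.
have mu1 : measurable_fun (Omega L h : set (measurableTypeR R * measurableTypeR R)) u.
  apply/(measurable_restrictT _ mO).
  by move: uL; rewrite inE => /andP[/[!inE]].
split => //; apply/(integrable_mkcond _ mO).
have := Lfun2_integrable_sqr uL; congr (integrable _ _ _).
apply/funext => y; rewrite /= !patchE; case: ifP => // _.
by rewrite /point/= expr0n.
Qed.

Lemma continuous_sqintegrable (R : realType) (L h : R) (f : R * R -> R) :
  0 < L -> 0 < h -> continuous f -> sqintegrable (leb2 R) (Omega L h) f.
Proof.
move=> L0 h0 cf; split.
  by apply: measurable_funTS; exact: continuous_measurable_prod.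
by apply: continuous_integrable_Omega => //; exact: continuous_sqr.
Qed.

Lemma leb2_Omega_lty (R : realType) (L h : R) : 0 < L -> 0 < h ->
  (leb2 R (Omega L h) < +oo)%E.
Proof. by move=> L0 h0; rewrite leb2_Omega// ltry. Qed.

(** A weighted Young inequality, exact up to a perfect square. The coefficient of the integral of
    [v ^+ 2] is one and [k] may approach one, so sharp constants survive the passage to the limit;
    the large factor [k / (1 - k)] only multiplies a vanishing distance. *)
Lemma Rintegral_sqr_close d (T : measurableType d) (R : realType)
    (mu : {measure set T -> \bar R}) (D : set T) (k : R) (u v : T -> R) :
  measurable D -> 0 < k < 1 -> sqintegrable mu D u -> sqintegrable mu D v ->
  k * \int[mu]_(x in D) u x ^+ 2 <= \int[mu]_(x in D) v x ^+ 2 +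
     k / (1 - k) * \int[mu]_(x in D) (v x - u x) ^+ 2.
Proof.
move=> mD /andP[k0 k1] uD vD; have [_ iw] := sqintegrableB mD vD uD.
have [_ iu] := uD; have [_ iv] := vD.
have k1' : 0 < 1 - k by rewrite subr_gt0.
have iw' := integrable_EFinZ (k / (1 - k)) mD iw.
rewrite -!RintegralZl// -RintegralD//.
apply: le_Rintegral => //; first exact: integrable_EFinZ.
  exact: integrable_EFinD.
move=> x _; rewrite -subr_ge0.
have -> : v x ^+ 2 + k / (1 - k) * (v x - u x) ^+ 2 - k * u x ^+ 2 =
   ((1 - k) * v x + k * (v x - u x)) ^+ 2 / (1 - k).
  by field; rewrite gt_eqF.
by rewrite divr_ge0 ?sqr_ge0// ltW.
Qed.

Lemma Rintegral_sqr_le_lim d (T : measurableType d) (R : realType)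
    (mu : {measure set T -> \bar R}) (D : set T) (K : R) (u v : T -> R)
    (u_ v_ : nat -> T -> R) (r e : nat -> R) :
  measurable D -> 0 <= K ->
  sqintegrable mu D u -> sqintegrable mu D v ->
  (forall n, sqintegrable mu D (u_ n)) -> (forall n, sqintegrable mu D (v_ n)) ->
  (forall n, \int[mu]_(x in D) (u_ n x - u x) ^+ 2 <= e n) ->
  (forall n, \int[mu]_(x in D) (v_ n x - v x) ^+ 2 <= e n) ->
  e @ \oo --> (0 : R) -> r @ \oo --> (0 : R) ->
  (forall n, K * \int[mu]_(x in D) u_ n x ^+ 2 <=
     \int[mu]_(x in D) v_ n x ^+ 2 + r n) ->
  K * \int[mu]_(x in D) u x ^+ 2 <= \int[mu]_(x in D) v x ^+ 2.
Proof.
move=> mD K0 uD vD u_D v_D ue ve e0 r0 H.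
(* The factor one is written as [1 ^+ 2] and weakened to [k ^+ 2]: one [k] pays for replacing [u] by
   [u_ n], the other for replacing [v_ n] by [v]. With [k] fixed, [n] tends to infinity. *)
rewrite -[leLHS]mul1r -[X in X * _](expr1n _ 2); apply: sqr_le_lim => // k k01.
have /andP[k0 k1] := k01.
have q0 : 0 < k / (1 - k) by rewrite divr_gt0// subr_gt0.
pose q := k / (1 - k).
have cv : (\int[mu]_(x in D) v x ^+ 2 + (q * e n + k * r n + K * k * q * e n)) @[n --> \oo] -->
    \int[mu]_(x in D) v x ^+ 2 + (q * 0 + k * 0 + K * k * q * 0).
  apply: cvgD; first exact: cvg_cst.
  by apply: cvgD; [apply: cvgD|]; apply: cvgM => //; exact: cvg_cst.
rewrite -[leRHS]addr0 (_ : 0 = q * 0 + k * 0 + K * k * q * 0); last by ring.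
apply: (cvgr_to_ge cv); near=> n.
have h1 := Rintegral_sqr_close mD k01 uD (u_D n).
have h2 := Rintegral_sqr_close mD k01 (v_D n) vD.
have E : \int[mu]_(x in D) (v x - v_ n x) ^+ 2 = \int[mu]_(x in D) (v_ n x - v x) ^+ 2.
  by apply: eq_Rintegral => x _; ring.
rewrite E in h2.
have h3 := ue n; have h4 := ve n; have h5 := H n.
move: h1 h2 h3 h4 h5; rewrite -/q.
set U := \int[mu]_(x in D) u x ^+ 2.
set V := \int[mu]_(x in D) v x ^+ 2.
set Un := \int[mu]_(x in D) u_ n x ^+ 2.
set Vn := \int[mu]_(x in D) v_ n x ^+ 2.
set A := \int[mu]_(x in D) _; set B := \int[mu]_(x in D) _ => h1 h2 h3 h4 h5.
have {}h1 : K * k * (k * U) <= K * k * (Un + q * A).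
  by apply: ler_wpM2l => //; rewrite mulr_ge0// ltW.
have {}h5 : k * (K * Un) <= k * (Vn + r n) by apply: ler_wpM2l => //; exact: ltW.
have {}h3 : K * k * q * A <= K * k * q * e n.
  by apply: ler_wpM2l => //; exact: (mulr_ge0 (mulr_ge0 K0 (ltW k0)) (ltW q0)).
have {}h4 : q * B <= q * e n by apply: ler_wpM2l => //; exact: ltW.
lra.
Unshelve. all: by end_near. Qed.

(** * Smooth functions and cutoffs *)

Lemma horner_bound (R : realType) (p : {poly R}) :
  exists n (C : R), 0 <= C /\ forall t, 1 <= t -> `|p.[t]| <= C * t ^+ n.
Proof.
elim/poly_ind: p => [|p c [n [C [C0 HC]]]].
  by exists 0%N, 0; split => // t _; rewrite horner0 normr0 mul0r.
exists n.+1, (C + `|c|); split; first by rewrite addr_ge0.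
move=> t t1; rewrite hornerMXaddC (le_trans (ler_normD _ _))// mulrDl.
have t0 : 0 <= t by rewrite (le_trans _ t1).
apply: lerD; last by rewrite ler_peMr// exprn_ege1.
by rewrite normrM exprSr mulrA (ger0_norm t0) ler_wpM2r// HC.
Qed.

(** The functions [p(1/x) exp(-1/x)], extended by zero. The family contains the standard flat
    function, at [p = 1], and is stable under differentiation, which gives smoothness without
    formulas for higher derivatives. *)
Definition bump_poly {R : realType} (p : {poly R}) (x : R) : R :=
  if 0 < x then p.[x^-1] * expR (- x^-1) else 0.

(** With [t = 1/x], the exponential dominates [t^(n+1) / (n+1)!], one power more than the growth of
    [p]; the spare power yields the factor [|x|]. *)
Lemma bump_poly_bound (R : realType) (p : {poly R}) :
  exists2 C : R, 0 <= C & forall x, `|x| <= 1 -> `|bump_poly p x| <= C * `|x|.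
Proof.
have [n [C [C0 HC]]] := horner_bound p.
exists (C * n.+1`!%:R); first by rewrite mulr_ge0.
move=> x x1; rewrite /bump_poly; case: ifPn => [x0|_]; last first.
  by rewrite normr0 !mulr_ge0.
rewrite (gtr0_norm x0) in x1 *.
have t1 : 1 <= x^-1 by rewrite invf_ge1.
have t0 : 0 < x^-1 by rewrite invr_gt0.
rewrite normrM (gtr0_norm (expR_gt0 _)) expRN.
apply: (@le_trans _ _ (C * x^-1 ^+ n * (expR x^-1)^-1)).
  by rewrite ler_wpM2r ?HC// invr_ge0 expR_ge0.
rewrite -!mulrA ler_wpM2l// ler_pdivrMr ?expR_gt0//.
have : x^-1 ^+ n.+1 / n.+1`!%:R <= expR x^-1.
  by rewrite (le_trans _ (expR_ge1Dxn n (ltW t0)))// lerDr.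
rewrite ler_pdivrMr ?ltr0n ?fact_gt0// => H.
rewrite -(ler_pM2l t0) -exprS (le_trans H)// mulrA mulrA.
by rewrite -mulrA [X in _ <= X](_ : _ = expR x^-1 * n.+1`!%:R)//; field; rewrite gt_eqF.
Qed.

(** For [t = 1/x] the derivative in [x] is [- t^2] times the derivative in [t], whence the
    polynomial [t^2 (p - p')]. At the origin the difference quotient is itself [bump_poly ('X * p)],
    which tends to zero by the linear bound. *)
Lemma is_derive_bump_poly (R : realType) (p : {poly R}) (x : R) :
  is_derive x 1 (bump_poly p) (bump_poly ('X^2 * (p - p^`())) x).
Proof.
have [x0|x0|->] := ltgtP x 0.
- apply: (@near_eq_is_derive _ _ _ (cst 0)).
    near=> y; rewrite /bump_poly ifF//; apply/negbTE; rewrite -leNgt ltW//.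
    by near: y; exact: lt_nbhsl.
  by rewrite /bump_poly ltNge (ltW x0)/=; exact: is_derive_cst.
- apply: (@near_eq_is_derive _ _ _ (fun y : R => p.[y^-1] * expR (- y^-1))).
    near=> y; rewrite /bump_poly ifT//.
    by near: y; exact: lt_nbhsr.
  have di : is_derive x 1 (fun y : R => y^-1) (- x ^- 2).
    have := @is_deriveV _ id x 1 1 _ _; rewrite gt_eqF// => /(_ isT (is_derive_id _ _)).
    by rewrite /GRing.scale/= mulr1.
  have dp := @is_derive1_comp _ (horner p) _ x _ _ (is_derive_poly p _) di.
  have de := @is_derive1_comp _ expR _ x _ _ (is_derive_expR _) (is_deriveN di).
  have := is_deriveM dp de; rewrite /bump_poly x0.
  move/is_derive_eq; apply; rewrite /GRing.scale/= !hornerE/=.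
  rewrite [(- GRing.inv)%R x]/GRing.opp/= -exprVn; ring.
have [C C0 HC] := bump_poly_bound ('X * p).
have cv : (h^-1 *: (bump_poly p (h *: (1 : R) + 0) - bump_poly p 0)) @[h --> 0^'] --> (0 : R).
  apply/cvgr0Pnorm_le => e e0; near=> h.
  have -> : h^-1 *: (bump_poly p (h *: (1 : R) + 0) - bump_poly p 0) = bump_poly ('X * p) h.
    rewrite /GRing.scale/= mulr1 addr0 /bump_poly ltxx subr0 hornerM hornerX.
    by case: ifP => _; rewrite ?mulr0// mulrA.
  apply: le_trans (HC h _) _.
    by apply/ltW; near: h; exact: dnbhs0_lt.
  have h1 : `|h| <= e / (C + 1).
    by apply/ltW; near: h; apply: dnbhs0_lt; rewrite divr_gt0// ltr_wpDl.
  rewrite (le_trans (ler_wpM2l C0 h1))// mulrA ler_pdivrMr ?ltr_wpDl//.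
  by rewrite mulrC ler_wpM2l ?ltW// ltrDl.
rewrite {2}/bump_poly ltxx; split; first by apply/cvg_ex; exists 0.
exact: cvg_lim cv.
Unshelve. all: by end_near. Qed.

Lemma bump_poly1_ge0_le1 (R : realType) (x : R) : 0 <= bump_poly 1 x <= 1.
Proof.
rewrite /bump_poly hornerC mul1r; case: ifPn => [x0|_]; last by rewrite lexx ler01.
by rewrite expR_ge0 -[leRHS](@expR0 R) ler_expR oppr_le0 invr_ge0 ltW.
Qed.

Lemma bump_poly1_cvg (R : realType) (x : R^nat) :
  x @ \oo --> +oo -> (fun n => bump_poly 1 (x n)) @ \oo --> (1 : R).
Proof.
move=> xoo.
have c : (fun n => expR (- (x n)^-1)) @ \oo --> (1 : R).
  rewrite -(@expR0 R) -oppr0; apply: (@continuous_cvg _ _ _ _ _ _ expR).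
    exact: continuous_expR.
  apply: cvgN; apply/gtr0_cvgV0 => //.
  by near=> n; near: n; move/cvgryPgt : xoo; exact.
apply: cvg_trans c; apply: near_eq_cvg; near=> n.
rewrite /bump_poly hornerC mul1r ifT//.
by near: n; move/cvgryPgt : xoo; exact.
Unshelve. all: by end_near. Qed.

(** A coinduction principle: smoothness is shown by exhibiting a family of functions stable under
    both partial derivatives. *)
Lemma Ck_coind (R : realType) (S : set (R * R -> R)) :
  (forall f, S f -> [/\ continuous f,
     forall y, derivable f y e1 /\ derivable f y e2, S ('D_e1 f) & S ('D_e2 f)]) ->
  forall k f, S f -> Ck k f.
Proof.
move=> HS; elim=> [|k IH] f /HS[cf df S1 S2] //=.
by split => //; split => //; split; exact: IH.
Qed.

Lemma CkS (R : realType) k (f : R * R -> R) : Ck k.+1 f -> Ck k f.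
Proof.
elim: k f => [|k IH] f; first by case=> _ [].
by case=> df [cf [/IH c1 /IH c2]].
Qed.

Lemma CkD (R : realType) k (f g : R * R -> R) : Ck k f -> Ck k g ->
  Ck k (fun y => f y + g y).
Proof.
elim: k f g => [|k IH] f g.
  by move=> cf cg y; apply: cvgD; [exact: cf|exact: cg].
move=> [df [cf [c1 c2]]] [dg [cg [d1 d2]]]; split.
  move=> y; have [df1 df2] := df y; have [dg1 dg2] := dg y.
  by split; exact: derivableD.
split; first by move=> y; apply: cvgD; [exact: cf|exact: cg].
rewrite (_ : 'D_e1 _ = (fun y => 'D_e1 f y + 'D_e1 g y)); last first.
  apply/funext => y; have [df1 _] := df y; have [dg1 _] := dg y.
  by rewrite -deriveD.
rewrite (_ : 'D_e2 _ = (fun y => 'D_e2 f y + 'D_e2 g y)); last first.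
  apply/funext => y; have [_ df2] := df y; have [_ dg2] := dg y.
  by rewrite -deriveD.
by split; exact: IH.
Qed.

Lemma is_derive_mul_pair (R : realType) (f g : R * R -> R) y v :
  derivable f y v -> derivable g y v ->
  derivable (fun y => f y * g y) y v /\
  'D_v (fun y => f y * g y) y = f y * 'D_v g y + g y * 'D_v f y.
Proof.
move=> df dg; have -> : (fun y => f y * g y) = f * g by apply/funext.
have dfg := @derivableM R (R * R)%type f g y v df dg.
have dfgE := @deriveM R (R * R)%type f g y v df dg.
by split; [exact: dfg|exact: dfgE].
Qed.

Lemma CkM (R : realType) k (f g : R * R -> R) : Ck k f -> Ck k g ->
  Ck k (fun y => f y * g y).
Proof.
elim: k f g => [|k IH] f g.
  by move=> cf cg y; apply: cvgM; [exact: cf|exact: cg].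
move=> Cf Cg; have C'f := CkS Cf; have C'g := CkS Cg.
move: Cf Cg => [df [cf [c1 c2]]] [dg [cg [d1 d2]]]; split.
  move=> y; have [df1 df2] := df y; have [dg1 dg2] := dg y.
  by split; [have [] := is_derive_mul_pair df1 dg1|have [] := is_derive_mul_pair df2 dg2].
split; first by move=> y; apply: cvgM; [exact: cf|exact: cg].
rewrite (_ : 'D_e1 _ = (fun y => f y * 'D_e1 g y + g y * 'D_e1 f y)); last first.
  apply/funext => y; have [df1 _] := df y; have [dg1 _] := dg y.
  by have [] := is_derive_mul_pair df1 dg1.
rewrite (_ : 'D_e2 _ = (fun y => f y * 'D_e2 g y + g y * 'D_e2 f y)); last first.
  apply/funext => y; have [_ df2] := df y; have [_ dg2] := dg y.
  by have [] := is_derive_mul_pair df2 dg2.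
by split; apply: CkD; exact: IH.
Qed.

Lemma is_derive_fst (R : realType) (F : R -> R) (y : R * R) d : is_derive y.1 1 F d ->
  is_derive y e1 (fun y => F y.1) d /\ is_derive y e2 (fun y => F y.1) 0.
Proof.
move=> [dF dFE]; split.
  have E : (fun t : R => t^-1 *: (F (t *: e1 + y).1 - F y.1)) =
      (fun t : R => t^-1 *: (F (t *: (1 : R) + y.1) - F y.1)) by [].
  by split; [rewrite /derivable E|rewrite /derive E].
have E : (fun t : R => t^-1 *: (F (t *: e2 + y).1 - F y.1)) = cst 0.
  by apply/funext => t; rewrite /= scaler0 add0r subrr scaler0.
split; rewrite /derivable/derive E; first by apply/cvg_ex; exists 0; exact: cvg_cst.
by apply: cvg_lim => //; exact: cvg_cst.
Qed.

Lemma is_derive_snd (R : realType) (F : R -> R) (y : R * R) d : is_derive y.2 1 F d ->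
  is_derive y e1 (fun y => F y.2) 0 /\ is_derive y e2 (fun y => F y.2) d.
Proof.
move=> [dF dFE]; split; last first.
  have E : (fun t : R => t^-1 *: (F (t *: e2 + y).2 - F y.2)) =
      (fun t : R => t^-1 *: (F (t *: (1 : R) + y.2) - F y.2)) by [].
  by split; [rewrite /derivable E|rewrite /derive E].
have E : (fun t : R => t^-1 *: (F (t *: e1 + y).2 - F y.2)) = cst 0.
  by apply/funext => t; rewrite /= scaler0 add0r subrr scaler0.
split; rewrite /derivable/derive E; first by apply/cvg_ex; exists 0; exact: cvg_cst.
by apply: cvg_lim => //; exact: cvg_cst.
Qed.

Lemma derive1_continuous (R : realType) (F F' : R -> R) :
  (forall x : R, is_derive x 1 F (F' x)) -> continuous F.
Proof.
move=> dF x; have [dFx _] := dF x; apply: differentiable_continuous.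
exact/derivable1_diffP.
Qed.

(** [S] has to contain zero because the derivative in the first variable vanishes. *)
Lemma Ck_snd (R : realType) (S : set (R -> R)) (F : R -> R) :
  (forall F, S F -> exists2 F', S F' & forall x : R, is_derive x 1 F (F' x)) ->
  S (cst 0) -> S F -> forall k, Ck k (fun y : R * R => F y.2).
Proof.
move=> dS S0 SF k.
pose T := [set f : R * R -> R | exists2 F, S F & f = (fun y => F y.2)].
apply: (@Ck_coind R T); last by exists F.
move=> _ [G SG ->]; have [G' SG' dG] := dS _ SG; split.
- move=> y; apply: (@continuous_comp _ _ _ (fun y : R * R => y.2) G); first exact: cvg_snd.
  exact: derive1_continuous dG _.
- by move=> y; have [[f1 _] [f2 _]] := is_derive_snd (y := y) (dG y.2); exact: (conj f1 f2).
- exists (cst 0) => //; apply/funext => y.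
  by have [[_ ->] _] := is_derive_snd (y := y) (dG y.2).
- exists G' => //; apply/funext => y.
  by have [_ [_ ->]] := is_derive_snd (y := y) (dG y.2).
Qed.

Lemma Ck_fst (R : realType) (S : set (R -> R)) (F : R -> R) :
  (forall F, S F -> exists2 F', S F' & forall x : R, is_derive x 1 F (F' x)) ->
  S (cst 0) -> S F -> forall k, Ck k (fun y : R * R => F y.1).
Proof.
move=> dS S0 SF k.
pose T := [set f : R * R -> R | exists2 F, S F & f = (fun y => F y.1)].
apply: (@Ck_coind R T); last by exists F.
move=> _ [G SG ->]; have [G' SG' dG] := dS _ SG; split.
- move=> y; apply: (@continuous_comp _ _ _ (fun y : R * R => y.1) G); first exact: cvg_fst.
  exact: derive1_continuous dG _.
- by move=> y; have [[f1 _] [f2 _]] := is_derive_fst (y := y) (dG y.1); exact: (conj f1 f2).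
- exists G' => //; apply/funext => y.
  by have [[_ ->] _] := is_derive_fst (y := y) (dG y.1).
- exists (cst 0) => //; apply/funext => y.
  by have [_ [_ ->]] := is_derive_fst (y := y) (dG y.1).
Qed.

Lemma is_derive_bump_affine (R : realType) (p : {poly R}) (c a x : R) :
  is_derive x 1 (fun x => bump_poly p (c * (x - a)))
    (bump_poly (c *: ('X^2 * (p - p^`()))) (c * (x - a))).
Proof.
have da : is_derive x 1 (fun x : R => c * (x - a)) c.
  by apply: is_derive_eq; rewrite /GRing.scale/= ?subr0 ?mulr1.
have := @is_derive1_comp _ (bump_poly p) _ x _ _ (is_derive_bump_poly p _) da.
move/is_derive_eq; apply; rewrite /bump_poly; case: ifP => _; last by rewrite mul0r.
by rewrite hornerZ; ring.
Qed.

Lemma Ck_bump_affine (R : realType) (c a : R) k :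
  Ck k (fun y : R * R => bump_poly 1 (c * (y.2 - a))).
Proof.
pose S := [set F : R -> R | exists p, F = (fun x => bump_poly p (c * (x - a)))].
apply: (@Ck_snd R S (fun x => bump_poly 1 (c * (x - a)))); last by exists 1.
- move=> _ [p ->]; eexists; last by move=> x; exact: is_derive_bump_affine.
  by exists (c *: ('X^2 * (p - p^`()))).
- exists 0; apply/funext => x; rewrite /bump_poly horner0 mul0r.
  by case: ifP.
Qed.

Lemma is_derive_trig (R : realType) (k a b x : R) :
  is_derive x 1 (fun x => a * cos (k * x) + b * sin (k * x))
    (k * b * cos (k * x) + - (k * a) * sin (k * x)).
Proof.
have dk : is_derive x 1 (fun x : R => k * x) k.
  by apply: is_derive_eq; rewrite /GRing.scale/= ?mulr1.
have dc := @is_derive1_comp _ cos (fun x : R => k * x) x _ _ (is_derive_cos _) dk.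
have ds := @is_derive1_comp _ sin (fun x : R => k * x) x _ _ (is_derive_sin _) dk.
have := is_deriveD (is_deriveZ a dc) (is_deriveZ b ds).
by move/is_derive_eq; apply; rewrite /GRing.scale/=; ring.
Qed.

Definition trig_set {R : realType} (k : R) : set (R -> R) :=
  [set F | exists a b, F = (fun x => a * cos (k * x) + b * sin (k * x))].

Lemma trig_set_derive (R : realType) (k : R) (F : R -> R) : trig_set k F ->
  exists2 F', trig_set k F' & forall x : R, is_derive x 1 F (F' x).
Proof.
move=> [a [b ->]]; eexists; last by move=> x; exact: is_derive_trig.
by exists (k * b), (- (k * a)).
Qed.

Lemma trig_set0 (R : realType) (k : R) : trig_set k (cst 0).
Proof. by exists 0, 0; apply/funext => x; rewrite !mul0r addr0. Qed.

Lemma trig_set_cos (R : realType) (k : R) : trig_set k (fun x => cos (k * x)).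
Proof. by exists 1, 0; apply/funext => x; rewrite mul1r mul0r addr0. Qed.

Lemma trig_set_sin (R : realType) (k : R) : trig_set k (fun x => sin (k * x)).
Proof. by exists 0, 1; apply/funext => x; rewrite mul1r mul0r add0r. Qed.

(** A product of a rising and a falling flat function, supported between [b / n.+3%:R] and
    [b - b / n.+3%:R]; [n.+3] keeps this interval nondegenerate for all [n]. There is no plateau:
    the slope [n.+1] drives both arguments to infinity at each point of []0, b[], where [exp(-1/x)]
    tends to one. Pointwise convergence and values in [[0, 1]] suffice for dominated convergence. *)
Definition cutoff {R : realType} (b : R) (n : nat) (t : R) : R :=
  bump_poly 1 (n.+1%:R * (t - b / n.+3%:R)) *
  bump_poly 1 (- n.+1%:R * (t - (b - b / n.+3%:R))).

Lemma cutoff_ge0_le1 (R : realType) (b : R) n t : 0 <= cutoff b n t <= 1.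
Proof.
have /andP[x0 x1] := bump_poly1_ge0_le1 (n.+1%:R * (t - b / n.+3%:R)).
have /andP[y0 y1] := bump_poly1_ge0_le1 (- n.+1%:R * (t - (b - b / n.+3%:R))).
by rewrite mulr_ge0//= mulr_ile1.
Qed.

Lemma cutoff_eq0 (R : realType) (b : R) n t :
  t \notin `[b / n.+3%:R, b - b / n.+3%:R] -> cutoff b n t = 0.
Proof.
rewrite in_itv/= negb_and -!ltNge /cutoff => /orP[H|H].
  rewrite {1}/bump_poly ifF ?mul0r//; apply/negbTE.
  by rewrite -leNgt pmulr_rle0// subr_le0 ltW.
rewrite {2}/bump_poly ifF ?mulr0//; apply/negbTE.
by rewrite -leNgt mulNr oppr_le0 pmulr_rge0// subr_ge0 ltW.
Qed.

Lemma cutoff_cvg1 (R : realType) (b t : R) : 0 < t < b ->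
  (fun n => cutoff b n t) @ \oo --> (1 : R).
Proof.
move=> /andP[t0 tb].
have b0 : 0 < b by exact: lt_trans tb.
have key (s : R) : 0 < s -> (fun n => n.+1%:R * (s - b / n.+3%:R)) @ \oo --> +oo.
  move=> s0; apply/cvgryPge => A; near=> n.
  have : (A + b) / s <= n.+1%:R.
    apply: (@le_trans _ _ n%:R); last by rewrite ler_nat.
    by near: n; exact: nbhs_infty_ger.
  rewrite ler_pdivrMr// => H.
  have H2 : n.+1%:R * (b / n.+3%:R) <= b.
    by rewrite mulrCA ger_pMr// ler_pdivrMr// mul1r ler_nat; do 2 apply: leqW.
  by rewrite mulrBr lerBrDr (le_trans _ H)// lerD2l.
rewrite -[X in _ --> X](mulr1 1); apply: cvgM; apply: bump_poly1_cvg; first exact: key.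
rewrite [X in X @ _](_ : _ = fun n => n.+1%:R * (b - t - b / n.+3%:R)).
  by apply: key; rewrite subr_gt0.
by apply/funext => n; rewrite mulNr -mulrN; congr (_ * _); rewrite opprB addrAC.
Unshelve. all: by end_near. Qed.

Lemma cutoff_cvg (R : realType) (b t : R) : 0 < b -> 0 < t ->
  (fun n => cutoff b n t) @ \oo --> ((t < b)%R%:R : R).
Proof.
move=> b0 t0; have [tb|bt] := ltP t b; first by apply: cutoff_cvg1; rewrite t0.
rewrite (_ : (fun n => _) = cst 0); first exact: cvg_cst.
apply/funext => n; apply: cutoff_eq0; rewrite in_itv/= negb_and -!ltNge.
by apply/orP; right; rewrite (lt_le_trans _ bt)// ltrBlDr ltrDl divr_gt0.
Qed.

Lemma cutoff_test (R : realType) (L h b : R) n : 0 < b <= h ->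
  test_function L h (fun y => cutoff b n y.2) /\
  forall y : R * R, 'D_e1 (fun y => cutoff b n y.2) y = 0.
Proof.
move=> /andP[b0 bh]; split; last first.
  move=> y; have d := is_deriveM (is_derive_bump_affine 1 n.+1%:R (b / n.+3%:R) y.2)
    (is_derive_bump_affine 1 (- n.+1%:R) (b - b / n.+3%:R) y.2).
  by have [[_ ->] _] := is_derive_snd (F := cutoff b n) d.
split; first by split => // k; apply: CkM; exact: Ck_bump_affine.
exists (b / n.+3%:R), (b - b / n.+3%:R); split; first by rewrite divr_gt0.
  by rewrite (lt_le_trans _ bh)// ltrBlDr ltrDl divr_gt0.
by move=> y; exact: cutoff_eq0.
Qed.

(** * Strip integrals of a weak horizontal derivative *)

Lemma subset_Omega (R : realType) (L h b : R) : b <= h -> Omega L b `<=` Omega L h.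
Proof.
move=> bh [x y] [/= xI]; rewrite !in_itv/= => /andP[y0 yb]; split => //=.
by rewrite in_itv/= y0 (lt_le_trans yb).
Qed.

(** A test function of [y_2] alone has zero horizontal derivative, so [v] integrates to zero against
    every cutoff; the cutoffs tend to the indicator of the strip, with [|v|] as majorant. This holds
    at every height [b], not merely almost every one, so [b] can be matched with the slices of a
    smooth function. *)
Lemma intO_weak_e1_eq0 (R : realType) (L h b : R) (u v : R * R -> R) :
  0 < L -> 0 < h -> 0 < b <= h -> L2 L h v -> weak_partial L h e1 u v ->
  intO L b v = 0.
Proof.
move=> L0 h0 bh vL2 uv; have /andP[b0 bh1] := bh.
have mO := measurable_Omega L h; have mOb := measurable_Omega L b.
have vS := L2_sqintegrable vL2.
have iv := sqintegrable_integrable mO (leb2_Omega_lty L0 h0) vS.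
have mv : measurable_fun (Omega L h : set (measurableTypeR R * measurableTypeR R)) v by case: vS.
have z n : intO L h (fun y => v y * cutoff b n y.2) = 0.
  have [tn dn] := cutoff_test L n bh.
  apply/eqP; rewrite -oppr_eq0 -(uv _ tn); apply/eqP.
  rewrite /intO (@eq_Rintegral _ _ _ _ _ (fun=> 0)) ?Rintegral_cst ?mul0r// => y _.
  by rewrite dn mulr0.
pose f (n : nat) (y : measurableTypeR R * measurableTypeR R) : \bar R :=
  (v y * cutoff b n y.2)%:E.
pose f0 (y : measurableTypeR R * measurableTypeR R) : \bar R :=
  ((v \_ (Omega L b)) y)%:E.
have mcut n : measurable_fun setT (fun y : measurableTypeR R * measurableTypeR R => cutoff b n y.2).
  apply: continuous_measurable_prod; have [[[_ /(_ 0%N)]]] := cutoff_test L n bh.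
  by [].
have mf n : measurable_fun (Omega L h) (f n).
  apply/measurable_EFinP; apply: measurable_funM => //.
  exact: (measurable_funTS (mcut n)).
have ff0 : {ae leb2 R, forall y, Omega L h y -> f ^~ y @ \oo --> f0 y}.
  apply: aeW => -[x y] [/= xI]; rewrite in_itv/= => /andP[y0 _].
  apply: cvg_EFin; first by apply: nearW.
  have -> : (v \_ (Omega L b)) (x, y) = v (x, y) * (y < b)%R%:R.
    rewrite patchE; have [yb|yb] := ltP y b.
      by rewrite mem_set ?mulr1//; split => //=; rewrite in_itv/= y0.
    by rewrite memNset ?mulr0// => -[_] /=; rewrite in_itv/= (ltNge y b) yb andbF.
  by apply: cvgM; [exact: cvg_cst|exact: cutoff_cvg].
have hb : Omega L h `&` Omega L b = Omega L b by apply/setIidr/subset_Omega.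
have mf0 : measurable_fun (Omega L h) f0.
  apply/measurable_EFinP/(measurable_restrict _ mOb mO); rewrite hb.
  by apply: measurable_funS mv => //; exact: subset_Omega.
have fv : {ae leb2 R, forall y n, Omega L h y -> (`|f n y| <= (abse \o (EFin \o v)) y)%E}.
  apply: aeW => y n _ /=; rewrite lee_fin normrM ler_piMr//.
  by have /andP[c0 c1] := cutoff_ge0_le1 b n y.2; rewrite ger0_norm.
have [_ _] := dominated_convergence mO mf mf0 ff0 (integrable_abse iv) fv.
have -> : [sequence (\int[leb2 R]_(x in Omega L h) f n x)%E]_n = cst 0%E.
  apply/funext => n /=; have := z n; rewrite /intO /Rintegral => zn.
  rewrite -[LHS]fineK ?zn//.
  apply: integrable_fin_num => //.
  apply: (le_integrable mO (mf n) _ iv) => y _ /=.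
  rewrite lee_fin normrM ler_piMr//.
  by have /andP[c0 c1] := cutoff_ge0_le1 b n y.2; rewrite ger0_norm.
move=> c; have E : (\int[leb2 R]_(x in Omega L h) f0 x)%E = 0%E.
  by apply: (cvg_unique _ c (cvg_cst 0%E)) => //; exact: ereal_hausdorff.
by rewrite /intO -hb Rintegral_mkcondr /Rintegral; have -> := E.
Qed.

(** * The Poincare inequality *)

Lemma Rintegral_subset_le d (T : measurableType d) (R : realType)
    (mu : {measure set T -> \bar R}) (D E : set T) (f : T -> R) :
  measurable D -> measurable E -> D `<=` E -> mu.-integrable E (EFin \o f) ->
  (forall x, E x -> 0 <= f x) ->
  \int[mu]_(x in D) f x <= \int[mu]_(x in E) f x.
Proof.
move=> mD mE DE iE f0; have iD : mu.-integrable D (EFin \o f) by exact: integrableS iE.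
rewrite /Rintegral; apply: fine_le; [exact: (integrable_fin_num mD iD)|exact: (integrable_fin_num mE iE)|].
apply: ge0_subset_integral => //.
by case/integrableP: iE.
Qed.

(** As [v] has zero integral over the strip below [b], the slice integral at [b] is the one at [0]
    plus the strip integral of ['D_e2 f - v]. Cauchy-Schwarz on the circle and on the strip gives
    the constants [2 pi L] and [2 pi L h]; the factors two come from squaring the sum. With [v] the
    weak vertical derivative of [w_2], both terms are small for approximants. *)
Lemma slice_mean_sqr_le (R : realType) (L h b : R) (f v : R * R -> R) :
  0 < L -> 0 < h -> 0 < b <= h -> Ck 1 f ->
  sqintegrable (leb2 R) (Omega L h) v -> intO L b v = 0 ->
  (\int[@lebesgue_measure R]_(x in `]0, 2 * pi * L[) f (x, b)) ^+ 2 <=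
  2 * (2 * pi * L) * \int[@lebesgue_measure R]_(x in `]0, 2 * pi * L[) f (x, 0) ^+ 2 +
  2 * (2 * pi * L * h) * intO L h (fun y => ('D_e2 f y - v y) ^+ 2).
Proof.
move=> L0 h0 /andP[b0 bh] Cf vS v0.
have [_ _ cf _ cf2] := Ck1P Cf.
have mO := measurable_Omega L h; have mOb := measurable_Omega L b.
have P0 : 0 < 2 * pi * L by rewrite !mulr_gt0// pi_gt0.
have vSb := sqintegrableS mO mOb (subset_Omega bh) vS.
have dS := continuous_sqintegrable L0 h0 cf2.
have dSb := continuous_sqintegrable L0 b0 cf2.
have iv := sqintegrable_integrable mOb (leb2_Omega_lty L0 b0) vSb.
have id := sqintegrable_integrable mOb (leb2_Omega_lty L0 b0) dSb.
have wSb := sqintegrableB mOb dSb vSb.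
have [_ iw] := sqintegrableB mO dS vS.
have E : intO L b (fun y => 'D_e2 f y - v y) = intO L b ('D_e2 f).
  by rewrite /intO RintegralB// -!/(intO _ _ _) v0 subr0.
have h1 := Rintegral_sqr_le mOb (leb2_Omega_lty L0 b0) wSb.
have mI : measurable (`]0, 2 * pi * L[%classic : set (measurableTypeR R)).
  exact: measurable_itv.
have h2 : (\int[@lebesgue_measure R]_(x in `]0, 2 * pi * L[) f (x, 0)) ^+ 2 <=
   2 * pi * L * \int[@lebesgue_measure R]_(x in `]0, 2 * pi * L[) f (x, 0) ^+ 2.
  have cf0 := continuous_slice1 (y := 0) cf.
  have Ifin : ((@lebesgue_measure R) `]0%R, (2 * pi * L)%R[%classic < +oo)%E.
    by rewrite lebesgue_itvoo ?(ltW P0)// ltry.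
  have IS : sqintegrable (@lebesgue_measure R) `]0, 2 * pi * L[ (fun x => f (x, 0)).
    split; first by apply: measurable_funTS; exact: continuous_measurable_fun.
    by apply: (@integrable_slice _ (fun x => f (x, 0) ^+ 2)); exact: continuous_sqr.
  have := Rintegral_sqr_le mI Ifin IS.
  by rewrite /= lebesgue_itvoo ?(ltW P0)//= subr0.
have h3 : intO L b (fun y => ('D_e2 f y - v y) ^+ 2) <=
    intO L h (fun y => ('D_e2 f y - v y) ^+ 2).
  apply: Rintegral_subset_le => //; first exact: subset_Omega.
  by move=> y _; exact: sqr_ge0.
have -> : \int[@lebesgue_measure R]_(x in `]0, 2 * pi * L[) f (x, b) =
    \int[@lebesgue_measure R]_(x in `]0, 2 * pi * L[) f (x, 0) +
    intO L b (fun y => 'D_e2 f y - v y).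
  by rewrite E (intO_De2 L0 b0 Cf) addrC subrK.
move: h1; rewrite leb2_Omega// -!/(intO _ _ _) /=.
set W := intO L b _; set Wb := intO L b _; set Wh := intO L h _ in h3 *.
set m := \int[_]_(_ in _) _ in h2 *; set M := \int[_]_(_ in _) _ in h2 *.
move=> h1.
have W0 : 0 <= Wh by apply: Rintegral_ge0 => y _; exact: sqr_ge0.
have h4 : 2 * pi * L * b * Wb <= 2 * pi * L * h * Wh.
  have Wb0 : 0 <= Wb by apply: Rintegral_ge0 => y _; exact: sqr_ge0.
  apply: ler_pM => //; first by rewrite mulr_ge0// ltW.
  by rewrite ler_pM2l.
have : (m + W) ^+ 2 <= 2 * m ^+ 2 + 2 * W ^+ 2 by have := sqr_ge0 (m - W); lra.
move=> h5; lra.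
Qed.

Lemma ae_impl d (T : measurableType d) (R : realType)
    (mu : {measure set T -> \bar R}) (P Q : T -> Prop) :
  (forall x, P x -> Q x) -> {ae mu, forall x, P x} -> {ae mu, forall x, Q x}.
Proof. by move=> PQ; apply: filterS. Qed.

Lemma intO_d2_eq0 (R : realType) (L h b : R) (w : H1 L h * H1 L h) :
  0 < L -> 0 < h -> 0 < b <= h -> H1sigma w -> intO L b (d2 w.2) = 0.
Proof.
move=> L0 h0 bh [div0 _]; have /andP[b0 bh1] := bh.
have mO := measurable_Omega L h; have mOb := measurable_Omega L b.
have S1 := L2_sqintegrable (d1_L2 w.1); have S2 := L2_sqintegrable (d2_L2 w.2).
have Sb1 := sqintegrableS mO mOb (subset_Omega bh1) S1.
have Sb2 := sqintegrableS mO mOb (subset_Omega bh1) S2.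
have i1 := sqintegrable_integrable mOb (leb2_Omega_lty L0 b0) Sb1.
have := intO_weak_e1_eq0 L0 h0 bh (d1_L2 w.1) (d1_weak w.1) => d10.
have -> : intO L b (d2 w.2) = intO L b (fun y => -1 * d1 w.1 y).
  rewrite /intO /Rintegral; congr fine; apply: ae_eq_integral => //.
  - by apply/measurable_EFinP; case: Sb2.
  - by apply/measurable_EFinP; apply: measurable_funM => //; case: Sb1.
  apply: ae_impl div0 => y H Hy; have := H (subset_Omega bh1 Hy) => /eqP.
  by rewrite addrC addr_eq0 mulN1r => /eqP ->.
by rewrite /intO RintegralZl// -/(intO _ _ _) d10 mulr0.
Qed.

(** The vertical and the horizontal inequality hold separately, each with its own sharp constant,
    along the same approximating sequence; they are added at the end. *)
Lemma H1sigma_poincare (R : realType) (L h : R) (w : H1 L h * H1 L h) :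
  0 < L -> 0 < h -> H1sigma w ->
  (pi ^+ 2 * h ^- 2 + L ^- 2) * intO L h (fun y => w.2 y ^+ 2) <=
  intO L h (fun y => d1 w.2 y ^+ 2) + intO L h (fun y => d2 w.2 y ^+ 2).
Proof.
move=> L0 h0 Hw; have [_ [f [f_smooth e0 tr]]] := Hw.
have mO := measurable_Omega L h.
have P0 : 0 < 2 * pi * L by rewrite !mulr_gt0// pi_gt0.
pose e n := intO L h (fun y => (f n y - w.2 y) ^+ 2 +
  ('D_e1 (f n) y - d1 w.2 y) ^+ 2 + ('D_e2 (f n) y - d2 w.2 y) ^+ 2).
pose b0 n := \int[@lebesgue_measure R]_(x in `]0, 2 * pi * L[) f n (x, 0) ^+ 2.
pose bh n := \int[@lebesgue_measure R]_(x in `]0, 2 * pi * L[) f n (x, h) ^+ 2.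
have b00 : b0 @ \oo --> (0 : R).
  have [_] := tr 0 (or_introl erefl); rewrite (_ : (fun n => _) = b0)//.
  by apply/funext => n; apply: eq_Rintegral => x _; rewrite /= subr0.
have bh0 : bh @ \oo --> (0 : R).
  have [_] := tr h (or_intror erefl); rewrite (_ : (fun n => _) = bh)//.
  by apply/funext => n; apply: eq_Rintegral => x _; rewrite /= subr0.
have C1 n : Ck 1 (f n) by case: (f_smooth n).
have uS := L2_sqintegrable (H1_L2 w.2).
have d1S := L2_sqintegrable (d1_L2 w.2).
have d2S := L2_sqintegrable (d2_L2 w.2).
have fS n : sqintegrable (leb2 R) (Omega L h) (f n).
  by have [_ _ cf _ _] := Ck1P (C1 n); exact: continuous_sqintegrable.
have f1S n : sqintegrable (leb2 R) (Omega L h) ('D_e1 (f n)).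
  by have [_ _ _ cf _] := Ck1P (C1 n); exact: continuous_sqintegrable.
have f2S n : sqintegrable (leb2 R) (Omega L h) ('D_e2 (f n)).
  by have [_ _ _ _ cf] := Ck1P (C1 n); exact: continuous_sqintegrable.
have D0 n := (sqintegrableB mO (fS n) uS).2.
have D1 n := (sqintegrableB mO (f1S n) d1S).2.
have D2 n := (sqintegrableB mO (f2S n) d2S).2.
have eE n : e n = intO L h (fun y => (f n y - w.2 y) ^+ 2) +
    intO L h (fun y => ('D_e1 (f n) y - d1 w.2 y) ^+ 2) +
    intO L h (fun y => ('D_e2 (f n) y - d2 w.2 y) ^+ 2).
  rewrite /e /intO RintegralD//; last exact: integrable_EFinD.
  by rewrite RintegralD.
have pos (u : R * R -> R) : 0 <= intO L h (fun y => u y ^+ 2).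
  by apply: Rintegral_ge0 => y _; exact: sqr_ge0.
have e_0 n : intO L h (fun y => (f n y - w.2 y) ^+ 2) <= e n.
  by rewrite eE -addrA lerDl addr_ge0// pos.
have e_1 n : intO L h (fun y => ('D_e1 (f n) y - d1 w.2 y) ^+ 2) <= e n.
  by rewrite eE addrAC lerDr addr_ge0// pos.
have e_2 n : intO L h (fun y => ('D_e2 (f n) y - d2 w.2 y) ^+ 2) <= e n.
  by rewrite eE lerDr addr_ge0// pos.
have H2 : (pi / h) ^+ 2 * intO L h (fun y => w.2 y ^+ 2) <=
    intO L h (fun y => d2 w.2 y ^+ 2).
  (* The order of limits matters: the factor [c] of the wall terms blows up as [k] approaches
     [pi / h], so [k] is fixed while the traces tend to zero. *)
  apply: sqr_le_lim; first by rewrite divr_gt0// pi_gt0.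
  move=> k k0h; pose c := k * tan (k * (h / 2)).
  apply: (@Rintegral_sqr_le_lim _ _ _ (leb2 R) (Omega L h) (k ^+ 2) _ _ f
    (fun n => 'D_e2 (f n)) (fun n => c * (b0 n + bh n)) e) => //.
  - exact: sqr_ge0.
  - rewrite -(mulr0 c) -[X in c * X]addr0; apply: cvgM; first exact: cvg_cst.
    exact: cvgD.
  - by move=> n; exact: dirichlet_cell_le.
have H1 : L^-1 ^+ 2 * intO L h (fun y => w.2 y ^+ 2) <=
    intO L h (fun y => d1 w.2 y ^+ 2).
  (* The bound of [slice_mean_sqr_le] with [v] equal to [d2 w.2], uniform in the height and tending
     to zero with the trace at the bottom and the [H^1] error. *)
  pose B n := 2 * (2 * pi * L) * b0 n + 2 * (2 * pi * L * h) * e n.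
  apply: (@Rintegral_sqr_le_lim _ _ _ (leb2 R) (Omega L h) (L^-1 ^+ 2) _ _ f
    (fun n => 'D_e1 (f n)) (fun n => L^-1 ^+ 2 * (B n / (2 * pi * L) * h)) e) => //.
  - exact: sqr_ge0.
  - rewrite (_ : 0 = L^-1 ^+ 2 * ((2 * (2 * pi * L) * 0 + 2 * (2 * pi * L * h) * 0) / (2 * pi * L) * h)).
      apply: cvgM; first exact: cvg_cst.
      apply: cvgM; last exact: cvg_cst.
      apply: cvgM; last exact: cvg_cst.
      by apply: cvgD; apply: cvgM => //; exact: cvg_cst.
    by rewrite !mulr0 addr0 !mul0r mulr0.
  move=> n; rewrite -lerBlDr -mulrBr; apply: wirtinger_cell_le => //.
    by case: (f_smooth n).
  move=> y; rewrite in_itv/= => /andP[y0 yh].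
  have yh' : 0 < y <= h by rewrite y0 ltW.
  apply: le_trans (slice_mean_sqr_le L0 h0 yh' (C1 n) d2S (intO_d2_eq0 L0 h0 yh' Hw)) _.
  by rewrite lerD2l ler_pM2l// !mulr_gt0// pi_gt0.
rewrite mulrDl addrC; apply: lerD; first by rewrite -exprVn.
by rewrite -exprVn -exprMn.
Qed.

(** * Upper bound of the quotient *)

Lemma ae_le_Rintegral d (T : measurableType d) (R : realType)
    (mu : {measure set T -> \bar R}) (D : set T) (f g : T -> R) : measurable D ->
  mu.-integrable D (EFin \o f) -> mu.-integrable D (EFin \o g) ->
  {ae mu, forall x, D x -> f x <= g x} ->
  \int[mu]_(x in D) f x <= \int[mu]_(x in D) g x.
Proof.
move=> mD fi gi fg; rewrite -subr_ge0 -RintegralB//.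
have gfi := integrable_EFinB mD gi fi.
have mgf : measurable_fun D (fun x => g x - f x).
  by apply/measurable_EFinP; case/integrableP: gfi.
(* The difference agrees almost everywhere with its absolute value, which is nonnegative at every
   point. *)
have -> : \int[mu]_(x in D) (g x - f x) = \int[mu]_(x in D) `|g x - f x|.
  rewrite /Rintegral; congr fine; apply: ae_eq_integral => //.
  - exact/measurable_EFinP.
  - by apply/measurable_EFinP; exact: measurableT_comp.
  by apply: ae_impl fg => x H Dx; rewrite ger0_norm// subr_ge0 H.
by apply: Rintegral_ge0 => x _; exact: normr_ge0.
Qed.

(** The norm of exponent [+oo] is defined as the essential supremum when the whole space has
    positive measure; this selects that case. *)
Lemma leb2_setT_gt0 (R : realType) : (0 < leb2 R setT)%E.
Proof.
have h1 : (0 < leb2 R (Omega 1 1))%E.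
  by rewrite leb2_Omega// lte_fin !mulr1 mulr_gt0// pi_gt0.
apply: lt_le_trans h1 _; apply: le_measure => //; rewrite inE.
  exact: measurable_Omega.
exact: measurableT.
Qed.

Lemma normLoo_le (R : realType) (L h M : R) (u : R * R -> R) : 0 <= M ->
  (forall y, Omega L h y -> `|u y| <= M) -> (normLoo L h u <= M%:E)%E.
Proof.
move=> M0 uM; rewrite /normLoo unlock leb2_setT_gt0.
apply/ess_supP; apply: aeW => y /=; rewrite lee_fin patchE.
by case: ifPn => [/set_mem/uM//|_]; rewrite normr0.
Qed.

Lemma ae_le_normLoo (R : realType) (L h : R) (u : R * R -> R) :
  {ae leb2 R, forall y, Omega L h y -> (`|u y|%:E <= normLoo L h u)%E}.
Proof.
rewrite /normLoo unlock leb2_setT_gt0.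
have := ess_sup_ge (leb2 R) (abse \o (EFin \o (u \_ (Omega L h)))).
by apply: ae_impl => y /= + Oy; rewrite patchE mem_set.
Qed.

Section den_num.
Context {R : realType} (L h : R) (rho : R -> R).
Hypotheses (L0 : 0 < L) (h0 : 0 < h).
Let r (y : R * R) := derive1 rho y.2.
Hypothesis mr : measurable_fun (Omega L h : set (measurableTypeR R * measurableTypeR R)) r.
Hypothesis r_bounded : exists2 M0 : R, 0 <= M0 & forall y, Omega L h y -> `|r y| <= M0.

Lemma integrable_bounded_mul (u : R * R -> R) :
  (leb2 R).-integrable (Omega L h) (EFin \o u) ->
  (leb2 R).-integrable (Omega L h) (EFin \o (fun y => r y * u y)).
Proof.
move=> iu; have [M0 M00 HM0] := r_bounded; have mO := measurable_Omega L h.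
have mu1 : measurable_fun (Omega L h : set (measurableTypeR R * measurableTypeR R)) u.
  by apply/measurable_EFinP; case/integrableP: iu.
apply: (le_integrable mO _ _ (integrable_EFinZ M0 mO iu)).
  by apply/measurable_EFinP; exact: measurable_funM.
move=> y Oy /=; rewrite lee_fin !normrM (ger0_norm M00) ler_wpM2r//.
exact: HM0.
Qed.

Lemma sqintegrable_bounded_mul (u : R * R -> R) :
  sqintegrable (leb2 R) (Omega L h) u ->
  (leb2 R).-integrable (Omega L h) (EFin \o (fun y => (r y * u y) ^+ 2)).
Proof.
move=> [mu1 iu].
have := integrable_bounded_mul (integrable_bounded_mul iu); congr (integrable _ _ _).
by apply/funext => y /=; congr EFin; ring.
Qed.

Lemma kappaC_denE (w : H1 L h * H1 L h) :
  kappaC_den rho w = intO L h (fun y => (r y * d1 w.2 y) ^+ 2) +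
    intO L h (fun y => (r y * d2 w.2 y) ^+ 2).
Proof.
have d1S := L2_sqintegrable (d1_L2 w.2).
have d2S := L2_sqintegrable (d2_L2 w.2).
rewrite /kappaC_den /intO -RintegralD//.
- exact: measurable_Omega.
- exact: sqintegrable_bounded_mul.
- exact: sqintegrable_bounded_mul.
Qed.

(** Writing [u] as [r^-1 * (r * u)] brings in the bound on the inverse weight, squared because the
    weight sits inside the square. *)
Lemma kappaC_den_ge (N : R) (w : H1 L h * H1 L h) :
  (forall y, Omega L h y -> r y != 0) ->
  {ae leb2 R, forall y, Omega L h y -> `|(r y)^-1| <= N} ->
  intO L h (fun y => d1 w.2 y ^+ 2) + intO L h (fun y => d2 w.2 y ^+ 2) <=
  N ^+ 2 * kappaC_den rho w.
Proof.
move=> r0 rN; have mO := measurable_Omega L h.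
have d1S := L2_sqintegrable (d1_L2 w.2).
have d2S := L2_sqintegrable (d2_L2 w.2).
have key (u : R * R -> R) : sqintegrable (leb2 R) (Omega L h) u ->
    intO L h (fun y => u y ^+ 2) <= N ^+ 2 * intO L h (fun y => (r y * u y) ^+ 2).
  move=> uS; have [_ iu] := uS; have iru := sqintegrable_bounded_mul uS.
  rewrite /intO -RintegralZl//; apply: ae_le_Rintegral => //.
    exact: integrable_EFinZ.
  apply: ae_impl rN => y H Oy; have {}H := H Oy.
  have {1}-> : u y = (r y)^-1 * (r y * u y) by rewrite mulKf// r0.
  rewrite exprMn ler_wpM2r ?sqr_ge0//.
  by rewrite -real_normK ?num_real// lerXn2r ?nnegrE// (le_trans _ H).
by rewrite kappaC_denE mulrDr; apply: lerD; exact: key.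
Qed.

Lemma kappaC_num_le (g M : R) (w : H1 L h * H1 L h) : 0 <= g ->
  {ae leb2 R, forall y, Omega L h y -> `|r y| <= M} ->
  kappaC_num g rho w <= g * (M * intO L h (fun y => w.2 y ^+ 2)).
Proof.
move=> g0 rM; have mO := measurable_Omega L h.
have [_ iu] := L2_sqintegrable (H1_L2 w.2).
rewrite /kappaC_num ler_wpM2l// /intO -RintegralZl//.
apply: ae_le_Rintegral => //.
- exact: integrable_bounded_mul.
- exact: integrable_EFinZ.
apply: ae_impl rM => y H Oy; rewrite ler_wpM2r ?sqr_ge0//.
exact: le_trans (ler_norm _) (H Oy).
Qed.

(** [M] and [N] are arbitrary almost everywhere bounds, so the same estimate serves the [L^oo] norms
    of a general weight and the exact values [a] and [a^-1] of a constant one. *)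
Lemma kappaC_le (g M N : R) : 0 < g -> 0 <= M ->
  (forall y, Omega L h y -> r y != 0) ->
  {ae leb2 R, forall y, Omega L h y -> `|r y| <= M} ->
  {ae leb2 R, forall y, Omega L h y -> `|(r y)^-1| <= N} ->
  (kappaC g L h rho <= (g * M * N ^+ 2 / (pi ^+ 2 * h ^- 2 + L ^- 2))%:E)%E.
Proof.
move=> g0 M0 r0 rM rN; apply: ge_ereal_sup => _ [w /= [Hw wd] <-]; rewrite lee_fin.
have h1 := kappaC_den_ge w r0 rN.
have h2 := kappaC_num_le w (ltW g0) rM.
have h3 := H1sigma_poincare L0 h0 Hw.
have d0 : 0 < kappaC_den rho w.
  rewrite lt_neqAle eq_sym wd /=; apply: Rintegral_ge0 => y _.
  by rewrite addr_ge0 ?sqr_ge0.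
have C0 : 0 < pi ^+ 2 * h ^- 2 + L ^- 2 :> R.
  by rewrite addr_gt0 ?mulr_gt0 ?invr_gt0 ?exprn_gt0 ?pi_gt0.
rewrite ler_pdivrMr// (le_trans h2)//.
rewrite mulrAC ler_pdivlMr//.
have := ler_wpM2l (mulr_ge0 (ltW g0) M0) (le_trans h3 h1).
set C := _ + L ^- 2; lra.
Qed.

End den_num.

(** * The extremal field *)

Lemma periodic1_derive (R : realType) (L : R) (e : R * R) (f : R * R -> R) :
  periodic1 L f -> periodic1 L ('D_e f).
Proof.
move=> fP y; rewrite /derive.
suff -> : (fun t : R => t^-1 *: (f (t *: e + (y.1 + 2 * pi * L, y.2)) - f (y.1 + 2 * pi * L, y.2))) =
    (fun t : R => t^-1 *: (f (t *: e + y) - f y)) by [].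
apply/funext => t; rewrite fP; congr (_ *: (_ - _)).
rewrite -(fP (t *: e + y)); congr f.
by rewrite [LHS]surjective_pairing /= addrA.
Qed.

Lemma continuous_L2 (R : realType) (L h : R) (f : R * R -> R) :
  0 < L -> 0 < h -> continuous f -> periodic1 L f -> L2 L h f.
Proof.
move=> L0 h0 cf fP; split => //; have mO := measurable_Omega L h.
have [mf if2] := continuous_sqintegrable L0 h0 cf.
have mr := (measurable_restrictT _ mO).1 mf.
rewrite inE; apply/andP; split; first by rewrite inE.
rewrite inE/= /finite_norm unlock /Lnorm; apply: poweR_lty.
move/(integrable_mkcond _ mO) : if2 => /integrableP[_].
apply: le_lt_trans; rewrite le_eqVlt; apply/orP; left; apply/eqP.
apply: eq_integral => y _; rewrite /= !patchE; case: ifP => _ /=.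
  by rewrite powR_mulrn// normrX.
by rewrite /point/= normr0 powR0.
Qed.

Lemma continuous_intOD (R : realType) (L h : R) (f g : R * R -> R) :
  0 < L -> 0 < h -> continuous f -> continuous g ->
  intO L h (fun y => f y + g y) = intO L h f + intO L h g.
Proof.
move=> L0 h0 cf cg; rewrite /intO RintegralD//.
- exact: measurable_Omega.
- exact: continuous_integrable_Omega.
- exact: continuous_integrable_Omega.
Qed.

Lemma continuous_intOZ (R : realType) (L h k : R) (f : R * R -> R) :
  0 < L -> 0 < h -> continuous f ->
  intO L h (fun y => k * f y) = k * intO L h f.
Proof.
move=> L0 h0 cf; rewrite /intO RintegralZl//.
- exact: measurable_Omega.
- exact: continuous_integrable_Omega.
Qed.

Lemma smooth_weak_partial (R : realType) (L h : R) (f : R * R -> R) :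
  0 < L -> 0 < h -> smooth_periodic L f ->
  weak_partial L h e1 f ('D_e1 f) /\ weak_partial L h e2 f ('D_e2 f).
Proof.
move=> L0 h0 [fP fS].
(* By the product rule, both directions reduce to the vanishing of the integral of ['D_e (f phi)]:
   by periodicity for [e1], and for [e2] because [phi] is zero on both walls. *)
suff key e (phi : R * R -> R) : test_function L h phi ->
    (forall f, Ck 1 f -> (forall y : R * R, derivable f y e) /\ continuous ('D_e f)) ->
    intO L h ('D_e (fun y => f y * phi y)) = 0 ->
    intO L h (fun y => f y * 'D_e phi y) = - intO L h (fun y => 'D_e f y * phi y).
  split => phi tphi; have [[phiP phiS] [a [b [a0 bh phi0]]]] := tphi;
    (apply: key => //; first by move=> u [du [cu [c1 c2]]];
      split; [move=> y; have [] := du y|]).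
  - by apply: intO_De1 => //; [exact: CkM|move=> y; rewrite fP phiP].
  - have phi_0 x : phi (x, 0) = 0 by apply: phi0; rewrite in_itv/= leNgt a0.
    have phi_h x : phi (x, h) = 0 by apply: phi0; rewrite in_itv/= (leNgt h) bh andbF.
    rewrite intO_De2//; last exact: CkM.
    rewrite -[RHS](subrr (\int[@lebesgue_measure R]_(x in `]0, 2 * pi * L[) 0)).
    by congr (_ - _); apply: eq_Rintegral => x _; rewrite ?phi_0 ?phi_h mulr0.
move=> [[phiP phiS] _] HC H.
have [df cdf] := HC _ (fS 1%N); have [dp cdp] := HC _ (phiS 1%N).
have cf := Ck_continuous (fS 0%N); have cp := Ck_continuous (phiS 0%N).
apply/eqP; rewrite -addr_eq0 -continuous_intOD//.
- rewrite -[X in _ == X]H; apply/eqP; congr intO; apply/funext => y.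
  by have [_ ->] := is_derive_mul_pair (df y) (dp y); rewrite [X in _ + X]mulrC.
- by move=> y; apply: cvgM; [exact: cf|exact: cdp].
- by move=> y; apply: cvgM; [exact: cdf|exact: cp].
Qed.

Lemma smooth_H1 (R : realType) (L h : R) (f : R * R -> R) :
  0 < L -> 0 < h -> smooth_periodic L f ->
  exists u : H1 L h, [/\ H1fun u = f, d1 u = 'D_e1 f & d2 u = 'D_e2 f].
Proof.
move=> L0 h0 fS; have [fP Cf] := fS; have [w1 w2] := smooth_weak_partial L0 h0 fS.
have [_ _ cf cf1 cf2] := Ck1P (Cf 1%N).
have l0 := continuous_L2 L0 h0 cf fP.
have l1 := continuous_L2 L0 h0 cf1 (periodic1_derive e1 fP).
have l2 := continuous_L2 L0 h0 cf2 (periodic1_derive e2 fP).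
by exists (MkH1 l0 l1 l2 w1 w2).
Qed.

Lemma Ck_cst (R : realType) (c : R) k : Ck k (fun _ : R * R => c).
Proof.
apply: (@Ck_snd R (range cst) (fun=> c)); [|by exists 0|by exists c].
by move=> _ [a _ <-]; exists (cst 0) => [|x]; [exists 0|exact: is_derive_cst].
Qed.

Section trial.
Context {R : realType} (L h : R).
Hypotheses (L0 : 0 < L) (h0 : 0 < h).
(** [k1] and [k2] are the lowest positive frequencies compatible with the period [2 pi L] and with a
    sine vanishing on both walls. *)
Let k1 : R := L^-1.
Let k2 : R := pi / h.
Let s1 (y : R * R) := sin (k1 * y.1).
Let c1 (y : R * R) := cos (k1 * y.1).
Let s2 (y : R * R) := sin (k2 * y.2).
Let c2 (y : R * R) := cos (k2 * y.2).

Let Cs1 k : Ck k s1.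
Proof.
exact: (Ck_fst (trig_set_derive (k := k1)) (trig_set0 k1) (trig_set_sin k1)).
Qed.
Let Cc1 k : Ck k c1.
Proof.
exact: (Ck_fst (trig_set_derive (k := k1)) (trig_set0 k1) (trig_set_cos k1)).
Qed.
Let Cs2 k : Ck k s2.
Proof.
exact: (Ck_snd (trig_set_derive (k := k2)) (trig_set0 k2) (trig_set_sin k2)).
Qed.
Let Cc2 k : Ck k c2.
Proof.
exact: (Ck_snd (trig_set_derive (k := k2)) (trig_set0 k2) (trig_set_cos k2)).
Qed.

Let trig1 y1 : k1 * (y1 + 2 * pi * L) = k1 * y1 + pi *+ 2.
Proof. by rewrite /k1; field; rewrite gt_eqF. Qed.
Let Ps1 : periodic1 L s1.
Proof. by move=> y; rewrite /s1 /= trig1 sinD2pi. Qed.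
Let Pc1 : periodic1 L c1.
Proof. by move=> y; rewrite /c1 /= trig1 cosD2pi. Qed.

Let ds (k x : R) : is_derive x 1 (fun x => sin (k * x)) (k * cos (k * x)).
Proof.
have := is_derive_trig k 0 1 x; rewrite (_ : (fun _ => _) = fun x => sin (k * x)).
  by move/is_derive_eq; apply; ring.
by apply/funext => z; rewrite mul0r mul1r add0r.
Qed.
Let dc (k x : R) : is_derive x 1 (fun x => cos (k * x)) (- k * sin (k * x)).
Proof.
have := is_derive_trig k 1 0 x; rewrite (_ : (fun _ => _) = fun x => cos (k * x)).
  by move/is_derive_eq; apply; ring.
by apply/funext => z; rewrite mul0r mul1r addr0.
Qed.

Let Ds1 y : 'D_e1 s1 y = k1 * c1 y /\ 'D_e2 s1 y = 0.
Proof. by have [[_ ->] [_ ->]] := is_derive_fst (y := y) (ds k1 y.1). Qed.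
Let Dc1 y : 'D_e1 c1 y = - k1 * s1 y /\ 'D_e2 c1 y = 0.
Proof. by have [[_ ->] [_ ->]] := is_derive_fst (y := y) (dc k1 y.1). Qed.
Let Ds2 y : 'D_e1 s2 y = 0 /\ 'D_e2 s2 y = k2 * c2 y.
Proof. by have [[_ ->] [_ ->]] := is_derive_snd (y := y) (ds k2 y.2). Qed.
Let Dc2 y : 'D_e1 c2 y = 0 /\ 'D_e2 c2 y = - k2 * s2 y.
Proof. by have [[_ ->] [_ ->]] := is_derive_snd (y := y) (dc k2 y.2). Qed.

Let DM (f g : R * R -> R) y : Ck 1 f -> Ck 1 g ->
  'D_e1 (fun y => f y * g y) y = f y * 'D_e1 g y + g y * 'D_e1 f y /\
  'D_e2 (fun y => f y * g y) y = f y * 'D_e2 g y + g y * 'D_e2 f y.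
Proof.
move=> [df _] [dg _]; have [f1 f2] := df y; have [g1 g2] := dg y.
by split; [have [] := is_derive_mul_pair f1 g1|have [] := is_derive_mul_pair f2 g2].
Qed.

Let I (f g : R * R -> R) := intO L h (fun y => f y ^+ 2 * g y ^+ 2).

Let cont2 (f g : R * R -> R) : Ck 1 f -> Ck 1 g ->
  continuous (fun y => f y ^+ 2 * g y ^+ 2).
Proof.
move=> /Ck_continuous cf /Ck_continuous cg y.
by apply: cvgM; [exact: (continuous_sqr cf)|exact: (continuous_sqr cg)].
Qed.

(* Integrating D_1 (s1 c1 g^2) over a period. *)
Let swap1 (g : R * R -> R) : Ck 1 g -> periodic1 L g ->
  (forall y, 'D_e1 g y = 0) -> I c1 g = I s1 g.
Proof.
move=> Cg Pg Dg.
have Cgg : Ck 1 (fun y => g y * g y) by exact: CkM.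
have Csc : Ck 1 (fun y => s1 y * c1 y) by exact: CkM.
have : intO L h ('D_e1 (fun y => s1 y * c1 y * (g y * g y))) = 0.
  apply: intO_De1 => //; first exact: CkM.
  by move=> y; rewrite Ps1 Pc1 Pg.
rewrite (_ : 'D_e1 _ = fun y => k1 * (c1 y ^+ 2 * g y ^+ 2) +
    (- k1) * (s1 y ^+ 2 * g y ^+ 2)); last first.
  apply/funext => y; rewrite (DM y Csc Cgg).1 (DM y (Cs1 1) (Cc1 1)).1.
  by rewrite (DM y Cg Cg).1 Dg (Ds1 y).1 (Dc1 y).1; ring.
rewrite continuous_intOD//; last 2 first.
- by move=> y; apply: cvgM; [exact: cvg_cst|exact: (cont2 (Cc1 1) Cg)].
- by move=> y; apply: cvgM; [exact: cvg_cst|exact: (cont2 (Cs1 1) Cg)].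
rewrite !continuous_intOZ//; [|exact: cont2|exact: cont2].
rewrite mulNr -mulrBr => /eqP; rewrite mulf_eq0 gt_eqF ?invr_gt0//=.
by rewrite subr_eq0 => /eqP.
Qed.

(** Integrating [D_2 (s2 c2 g^2)] over the height: [s2] is zero on both walls. *)
Let swap2 (g : R * R -> R) : Ck 1 g ->
  (forall y, 'D_e2 g y = 0) -> I g c2 = I g s2.
Proof.
move=> Cg Dg.
have Cgg : Ck 1 (fun y => g y * g y) by exact: CkM.
have Csc : Ck 1 (fun y => s2 y * c2 y) by exact: CkM.
have : intO L h ('D_e2 (fun y => s2 y * c2 y * (g y * g y))) = 0.
  rewrite intO_De2//; last exact: CkM.
  rewrite -[RHS](subrr (\int[@lebesgue_measure R]_(x in `]0, 2 * pi * L[) 0)).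
  congr (_ - _); apply: eq_Rintegral => x _; rewrite /s2 /=.
    by rewrite /k2 divfK ?gt_eqF// sinpi !mul0r.
  by rewrite mulr0 sin0 !mul0r.
rewrite (_ : 'D_e2 _ = fun y => k2 * (g y ^+ 2 * c2 y ^+ 2) +
    (- k2) * (g y ^+ 2 * s2 y ^+ 2)); last first.
  apply/funext => y; rewrite (DM y Csc Cgg).2 (DM y (Cs2 1) (Cc2 1)).2.
  by rewrite (DM y Cg Cg).2 Dg (Ds2 y).2 (Dc2 y).2; ring.
rewrite continuous_intOD//; last 2 first.
- by move=> y; apply: cvgM; [exact: cvg_cst|exact: (cont2 Cg (Cc2 1))].
- by move=> y; apply: cvgM; [exact: cvg_cst|exact: (cont2 Cg (Cs2 1))].
rewrite !continuous_intOZ//; [|exact: cont2|exact: cont2].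
rewrite mulNr -mulrBr => /eqP; rewrite mulf_eq0 gt_eqF ?divr_gt0 ?pi_gt0//=.
by rewrite subr_eq0 => /eqP.
Qed.

(** The four integrals of products of a squared sine or cosine in each variable add up to the area
    of the cell, and the swaps make them equal; no integral of a trigonometric function is
    evaluated. *)
Let U_gt0 : 0 < I s1 s2.
Proof.
have Pc2 : periodic1 L c2 by [].
have Ps2 : periodic1 L s2 by [].
have e1 : I c1 s2 = I s1 s2 by apply: swap1 => // y; case: (Ds2 y).
have e2 : I s1 c2 = I s1 s2 by apply: swap2 => // y; case: (Ds1 y).
have e3 : I c1 c2 = I s1 s2 by rewrite -e2; apply: swap1 => // y; case: (Dc2 y).
have P0 : 0 < 2 * pi * L by rewrite !mulr_gt0// pi_gt0.
have E : intO L h (fun=> 1) = I s1 s2 + I s1 c2 + (I c1 s2 + I c1 c2).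
  rewrite /I -!continuous_intOD//; do ?exact: cont2; last 2 first.
  - by move=> y; apply: cvgD; apply: cont2.
  - by move=> y; apply: cvgD; apply: cont2.
  congr intO; apply/funext => y; rewrite -!mulrDr -mulrDl.
  by rewrite [s2 y ^+ 2 + _]addrC cos2Dsin2 !mulr1 addrC cos2Dsin2.
have : 0 < intO L h (fun=> 1).
  rewrite /intO Rintegral_cst; last exact: measurable_Omega.
  by rewrite leb2_Omega// mul1r /= mulr_gt0.
by rewrite E e1 e2 e3; lra.
Qed.

(** The quotient sees only [w_2]; the companion [w_1 = (k2 / k1) cos (k1 y_1) cos (k2 y_2)] is
    chosen to make the divergence vanish. The gradient gives [k1^2] and [k2^2] times integrals that
    the swaps identify with that of [w_2^2]. *)
Lemma exists_trial : exists w : H1 L h * H1 L h,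
  [/\ H1sigma w, 0 < intO L h (fun y => w.2 y ^+ 2) &
   intO L h (fun y => d1 w.2 y ^+ 2) + intO L h (fun y => d2 w.2 y ^+ 2) =
   (pi ^+ 2 * h ^- 2 + L ^- 2) * intO L h (fun y => w.2 y ^+ 2)].
Proof.
have su : smooth_periodic L (fun y => s1 y * s2 y).
  split; first by move=> y; rewrite Ps1.
  by move=> k; exact: CkM.
have sv : smooth_periodic L (fun y => k2 / k1 * (c1 y * c2 y)).
  split; first by move=> y; rewrite Pc1.
  by move=> k; apply: CkM; [exact: Ck_cst|exact: CkM].
have [u [uE u1E u2E]] := smooth_H1 L0 h0 su.
have [v [vE v1E v2E]] := smooth_H1 L0 h0 sv.
have D1u y : 'D_e1 (fun y => s1 y * s2 y) y = k1 * (c1 y * s2 y).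
  by rewrite (DM y (Cs1 1) (Cs2 1)).1 (Ds1 y).1 (Ds2 y).1; ring.
have D2u y : 'D_e2 (fun y => s1 y * s2 y) y = k2 * (s1 y * c2 y).
  by rewrite (DM y (Cs1 1) (Cs2 1)).2 (Ds1 y).2 (Ds2 y).2; ring.
have D1v y : 'D_e1 (fun y => k2 / k1 * (c1 y * c2 y)) y = - k2 * (s1 y * c2 y).
  rewrite (DM y (Ck_cst _ 1) (CkM (Cc1 1) (Cc2 1))).1 (DM y (Cc1 1) (Cc2 1)).1.
  have -> : 'D_e1 (fun _ : R * R => k2 / k1) y = 0 by exact: derive_cst.
  by rewrite (Dc1 y).1 (Dc2 y).1; field; rewrite invr_neq0 ?gt_eqF.
have Ic1 : I c1 s2 = I s1 s2 by apply: swap1 => // y; case: (Ds2 y).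
have Ic2 : I s1 c2 = I s1 s2 by apply: swap2 => // y; case: (Ds1 y).
exists (v, u); rewrite /= uE u1E u2E.
have UE : intO L h (fun y => (s1 y * s2 y) ^+ 2) = I s1 s2.
  by congr intO; apply/funext => y; rewrite exprMn.
split.
- split; first by apply: aeW => y _; rewrite /= v1E u2E D1v D2u; ring.
  (* [w_2] is smooth, so a constant sequence realises its trace. *)
  exists (fun _ y => s1 y * s2 y); split => //.
    rewrite (_ : (fun _ : nat => _) = cst 0); first exact: cvg_cst.
    apply/funext => n; rewrite /= uE u1E u2E /intO.
    rewrite (@eq_Rintegral _ _ _ _ _ (fun=> 0)) ?Rintegral_cst ?mul0r//.
      exact: measurable_Omega.
    by move=> y _; rewrite !subrr expr0n /= !addr0.
  move=> b b0h; split.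
    rewrite (_ : _ \_ _ = cst 0); last first.
      by apply/funext => x; rewrite patchE; case: ifP.
    rewrite inE; apply/andP; split; rewrite inE/=; first exact: measurable_cst.
    by rewrite /finite_norm Lnorm0// ltry.
  rewrite (_ : (fun _ : nat => _) = cst 0); first exact: cvg_cst.
  apply/funext => n; rewrite /=.
  rewrite (@eq_Rintegral _ _ _ _ _ (fun=> 0)) ?Rintegral_cst ?mul0r//.
  move=> x _; rewrite subr0 (_ : s2 (x, b) = 0) ?mulr0 ?expr0n//.
  case: b0h => ->; rewrite /s2 /= ?mulr0 ?sin0//.
  by rewrite /k2 divfK ?gt_eqF// sinpi.
- by rewrite UE.
- rewrite UE (_ : (fun y => 'D_e1 (fun y => s1 y * s2 y) y ^+ 2) = fun y => k1 ^+ 2 * (c1 y ^+ 2 * s2 y ^+ 2)); last first.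
    by apply/funext => y; rewrite D1u; ring.
  rewrite (_ : (fun y => 'D_e2 (fun y => s1 y * s2 y) y ^+ 2) = fun y => k2 ^+ 2 * (s1 y ^+ 2 * c2 y ^+ 2)); last first.
    by apply/funext => y; rewrite D2u; ring.
  rewrite !continuous_intOZ//; [|exact: cont2|exact: cont2].
  rewrite -!/(I _ _) Ic1 Ic2 /k1 /k2 -!exprVn; ring.
Qed.

End trial.

(** * The weight and the theorem *)

Section drho.
Context {R : realType} (L h : R) (rho : R -> R).
Hypothesis rho_C1 : exists r : R -> R, {within `[0, h], continuous r} /\
      {in `]0, h[, derive1 rho =1 r}.

Lemma drho_bounded :
  exists2 M0 : R, 0 <= M0 & forall y, Omega L h y -> `|derive1 rho y.2| <= M0.
Proof.
have [r [cr rE]] := rho_C1.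
have : bounded_set (r @` `[0, h]).
  by apply/compact_bounded/continuous_compact => //; exact: segment_compact.
case=> M [_ HM]; exists (`|M| + 1); first by rewrite addr_ge0.
move=> [x y] [/= _ yJ]; rewrite (rE _ yJ); apply: HM.
  by rewrite (le_lt_trans (ler_norm _))// ltrDl.
by exists y => //; exact: subset_itv_oo_cc.
Qed.

Lemma measurable_drho : measurable_fun
  (Omega L h : set (measurableTypeR R * measurableTypeR R))
  (fun y => derive1 rho y.2).
Proof.
have [r [cr rE]] := rho_C1.
have mr : measurable_fun (`]0, h[%classic : set (measurableTypeR R)) (derive1 rho).
  apply: (@eq_measurable_fun _ _ _ _ _ r).
    by move=> y /set_mem yJ; rewrite rE.
  apply: (@measurable_funS _ _ _ _ `[0, h]%classic) => //.
    exact: subset_itv_oo_cc.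
  exact: subspace_continuous_measurable_fun.
apply: (measurable_comp _ _ mr); first exact: measurable_itv.
  by move=> _ [y [_ yJ] <-].
exact: measurable_funTS.
Qed.

(** A sign change of [rho'] would give, by the intermediate value theorem for its continuous
    extension [r], a zero inside the interval, against the positive lower bound on [|rho'|]. *)
Lemma drho_gt0 : (exists2 s : R, s \in `]0, h[ & 0 < derive1 rho s) ->
  (0 < ereal_inf [set `|derive1 rho y|%:E | y in `]0%R, h[])%E ->
  exists2 m : R, 0 < m & forall y, y \in `]0, h[ -> m <= derive1 rho y.
Proof.
move=> [s sJ s_pos] inf_pos; have [r [cr rE]] := rho_C1.
have [m m0 Hm] : exists2 m : R, 0 < m & forall y, y \in `]0, h[ -> m <= `|derive1 rho y|.
  have lb y : y \in `]0, h[ -> (ereal_inf [set `|derive1 rho y|%:E | y in `]0%R, h[] <= `|derive1 rho y|%:E)%E.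
    by move=> yJ; apply: ereal_inf_lbound; exists y.
  move: inf_pos lb; case: (ereal_inf _) => [m||]//.
    by rewrite lte_fin => m0 lb; exists m => // y /lb; rewrite lee_fin.
  (* The infimum cannot be [+oo], being at most its value at [s]. *)
  by move=> _ lb; have := lb _ sJ.
exists m => // y yJ; suff : 0 <= derive1 rho y by move/ger0_norm <-; exact: Hm.
rewrite leNgt; apply/negP => y_neg.
have sub (a b : R) : a \in `]0, h[ -> b \in `]0, h[ -> `[a, b] `<=` `[0, h].
  move=> /[!in_itv]/= /andP[a0 _] /andP[_ bh] z /=; rewrite !in_itv/= => /andP[az zb].
  by rewrite (le_trans (ltW a0) az) (le_trans zb (ltW bh)).
have key (a b : R) : a \in `]0, h[ -> b \in `]0, h[ -> a <= b ->
    minr (r a) (r b) <= 0 <= maxr (r a) (r b) -> False.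
  move=> aJ bJ ab H.
  have cab : {within `[a, b], continuous r} by apply: continuous_subspaceW cr; exact: sub.
  have [c cab' rc] := IVT ab cab H.
  have cJ : c \in `]0, h[.
    move: aJ bJ cab'; rewrite !in_itv/= => /andP[a0 _] /andP[_ bh] /andP[ac cb].
    by rewrite (lt_le_trans a0 ac) (le_lt_trans cb bh).
  by have := Hm _ cJ; rewrite rE// rc normr0 leNgt m0.
rewrite rE// in y_neg; rewrite rE// in s_pos.
have [sy|ys] := leP s y.
  by apply: (key s y) => //; rewrite ge_min le_max (ltW y_neg) (ltW s_pos) orbT.
by apply: (key y s) => //; [exact: ltW|rewrite ge_min le_max (ltW y_neg) (ltW s_pos) orbT].
Qed.

End drho.

Lemma normLoo_fin (R : realType) (L h M : R) (u : R * R -> R) : 0 <= M ->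
  (forall y, Omega L h y -> `|u y| <= M) ->
  exists2 c : R, 0 <= c & normLoo L h u = c%:E.
Proof.
move=> M0 uM; have := normLoo_le M0 uM.
have := Lnorm_ge0 (leb2 R) +oo%E (EFin \o (u \_ (Omega L h))); rewrite -/(normLoo L h u).
case: (normLoo L h u) => // c; rewrite lee_fin => c0 _.
by exists c.
Qed.

Theorem mainTheorem3 (R : realType) (g L h : R) (rho : R -> R)
  (g_gt0 : 0 < g) (L_gt0 : 0 < L) (h_gt0 : 0 < h)
  (rho_C5 : Ck_closed 5 h rho)
  (rho_inf : (0 < ereal_inf [set (rho y)%:E | y in `]0%R, h[])%E)
  (drho_pos : exists2 s : R, s \in `]0, h[ & 0 < derive1 rho s)
  (drho_inf : (0 < ereal_inf [set `|derive1 rho y|%:E | y in `]0%R, h[])%E) :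
  (0 < kappaC g L h rho)%E /\
  (kappaC g L h rho <=
     g%:E * normLoo L h (fun y => derive1 rho y.2)
          * normLoo L h (fun y => ((derive1 rho y.2)^-1)%R) ^+ 2
     * ((pi ^+ 2 * h ^- 2 + L ^- 2)^-1)%R%:E)%E /\
  (forall a b : R, (forall y, y \in `]0, h[ -> rho y = a * y + b) ->
     [/\ 0 < a,
         forall y, y \in `]0, h[ -> derive1 rho y = a &
         kappaC g L h rho = (g / ((pi ^+ 2 * h ^- 2 + L ^- 2) * a))%:E]).
Proof.
have C1 : exists r : R -> R, {within `[0, h], continuous r} /\
    {in `]0, h[, derive1 rho =1 r} by have [_] := rho_C5 1%N isT.
have mr := measurable_drho (L := L) C1; have br := drho_bounded L C1.
have [m m0 mle] := drho_gt0 C1 drho_pos drho_inf.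
have r_gt0 y : Omega L h y -> 0 < derive1 rho y.2.
  by move=> [_ yJ]; exact: lt_le_trans m0 (mle _ yJ).
have r_neq0 y : Omega L h y -> derive1 rho y.2 != 0 by move/r_gt0; rewrite lt0r => /andP[].
have mO := measurable_Omega L h.
have pC : 0 < pi ^+ 2 * h ^- 2 + L ^- 2 :> R.
  by rewrite addr_gt0 ?mulr_gt0 ?invr_gt0 ?exprn_gt0 ?pi_gt0.
have rinv y : Omega L h y -> `|(derive1 rho y.2)^-1| <= m^-1.
  move=> Oy; have := r_gt0 _ Oy; case: Oy => _ yJ r0.
  by rewrite normfV gtr0_norm// lef_pV2 ?posrE// mle.
have rinv_ae : {ae leb2 R, forall y, Omega L h y -> `|(derive1 rho y.2)^-1| <= m^-1}.
  by apply: aeW => y; exact: rinv.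
have [w [Hw U0 AB]] := exists_trial L_gt0 h_gt0.
set U := intO L h (fun y => w.2 y ^+ 2) in U0 AB.
have iu := (L2_sqintegrable (H1_L2 w.2)).2.
(* The inverse weight is at most [m^-1], so the positive Dirichlet energy of the trial field forces
   a positive weighted one; this admits [w] to the supremum. *)
have den_gt0 : 0 < kappaC_den rho w.
  have := kappaC_den_ge mr br w r_neq0 rinv_ae.
  rewrite AB => H; have : 0 < m^-1 ^+ 2 * kappaC_den rho w.
    by apply: lt_le_trans H; rewrite mulr_gt0.
  by rewrite pmulr_rgt0// exprn_gt0// invr_gt0.
have kappa_ge : ((kappaC_num g rho w / kappaC_den rho w)%:E <= kappaC g L h rho)%E.
  by apply: ereal_sup_ubound; exists w => //; split => //; rewrite gt_eqF.
split; last split.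
- apply: lt_le_trans kappa_ge; rewrite lte_fin divr_gt0// mulr_gt0//.
  apply: (@lt_le_trans _ _ (m * U)); first exact: mulr_gt0.
  rewrite /U /intO -RintegralZl//; apply: le_Rintegral => //.
  + exact: integrable_EFinZ.
  + exact: integrable_bounded_mul.
  + by move=> y [_ yJ]; rewrite ler_wpM2r ?sqr_ge0// mle.
- have [M0 M00 HM0] := br.
  have [M M_ge0 ME] := normLoo_fin M00 HM0.
  have minv_ge0 : 0 <= m^-1 by rewrite invr_ge0 ltW.
  have [N N_ge0 NE] := normLoo_fin minv_ge0 rinv.
  (* Both norms are finite, so the extended-real bound is the image of a real number. *)
  rewrite ME NE -EFin_expe -!EFinM.
  apply: kappaC_le => //.
  + by apply: ae_impl (ae_le_normLoo L h (fun y => derive1 rho y.2)) => y H /H; rewrite ME lee_fin.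
  + by apply: ae_impl (ae_le_normLoo L h (fun y => (derive1 rho y.2)^-1)) => y H /H; rewrite NE lee_fin.
move=> a b rho_lin.
have da y : y \in `]0, h[ -> derive1 rho y = a.
  move=> yJ; rewrite derive1E.
  have : is_derive y 1 (fun y : R => a * y + b) a.
    by apply: is_derive_eq; rewrite /GRing.scale/= ?mulr1 ?addr0.
  (* [rho] is affine only on the open interval, which is a neighbourhood of [y]. *)
  move=> [_ <-]; apply: near_eq_derive; near=> z; apply: rho_lin.
  by near: z; exact: near_in_itvoo.
have a0 : 0 < a by case: drho_pos => s sJ; rewrite da.
split => //; apply/le_anti/andP; split.
  (* The general upper bound with [M = a] and [N = a^-1]. *)
  have CE (C : R) : 0 < C -> g / (C * a) = g * a * (a^-1) ^+ 2 / C.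
    by move=> C0; field; rewrite !gt_eqF.
  rewrite CE//.
  apply: kappaC_le => //; first exact: ltW.
    by apply: aeW => y [_ yJ]; rewrite da// gtr0_norm.
  by apply: aeW => y [_ yJ]; rewrite da// gtr0_norm ?invr_gt0.
(* With a constant weight the trial field attains the bound: its quotient is [g a U / (a^2 C U)],
   where [C] is the Poincare constant. *)
apply: le_trans kappa_ge; rewrite lee_fin le_eqVlt; apply/orP; left; apply/eqP.
have -> : kappaC_num g rho w = g * (a * U).
  rewrite /kappaC_num; congr (_ * _); rewrite /U /intO -RintegralZl//.
  by apply: eq_Rintegral => y /set_mem[_ yJ]; rewrite da.
have -> : kappaC_den rho w = a ^+ 2 * ((pi ^+ 2 * h ^- 2 + L ^- 2) * U).
  rewrite -AB kappaC_denE// mulrDr /intO -!RintegralZl//.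
  + by congr (_ + _); apply: eq_Rintegral => y /set_mem[_ yJ]; rewrite da// exprMn.
  + exact: (L2_sqintegrable (d2_L2 w.2)).2.
  + exact: (L2_sqintegrable (d1_L2 w.2)).2.
have CE (C : R) : 0 < C -> g / (C * a) = g * (a * U) / (a ^+ 2 * (C * U)).
  by move=> C0; field; rewrite !gt_eqF.
exact: CE.
Unshelve. all: by end_near. Qed.
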